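(* Let $G$ be a finite metabelian group having a maximal abelian normal subgroup which is of prime power order and contains the derived subgroup $G'$ (equivalently, has abelian quotient). Let $F$ be an arbitrary field of characteristic $0$ and $\overline{F}$ its algebraic closure. Then the following hold (the assertions concern the faithful irreducible representations of $G$, if they exist). (1) If $\rho,\rho'$ are two inequivalent faithful irreducible $\overline{F}$-representations of $G$, then $m_F(\rho)=m_F(\rho')$, where $m_F$ denotes the Schur index with respect to $F$. (2) All the faithful irreducible representations of $G$ over $F$ have the same degree. (3) The Schur index with respect to $F$ of any faithful irreducible $\overline{F}$-representation of $G$ is $1$ or $2$. (4) Let $K$ be any maximal abelian normal subgroup of $G$ of prime power order containing $G'$, and let $p^n$ ($p$ prime) be the exponent of $K$. Then the common degree of the faithful irreducible representations of $G$ over $F$ is equal to $[G:I]\,d$ or $2[G:I]\,d$, where $d$ is the common degree of the irreducible factors of the $p^n$-th cyclotomic polynomial in $F[X]$. Here $d$ also equals the common degree of the irreducible representations of $K$ over $F$ whose kernel is core-free in $G$, and $I$ is the common inertia subgroup in $G$ of all such representations of $K$.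
   Context: A maximal abelian normal subgroup of $G$ is a subgroup that is maximal (under inclusion) among the abelian normal subgroups of $G$. A subgroup $H\le G$ is core-free in $G$ if the intersection of all $G$-conjugates of $H$ is trivial. Schur index: let $\rho$ be an irreducible $\overline{F}$-representation of $G$ with character $\chi$, and let $F(\chi)$ be the field obtained from $F$ by adjoining all values $\chi(g)$, $g\in G$. The Schur index $m_F(\rho)$ is the minimal positive integer $m$ such that $m\chi$ is the character of an $F(\chi)$-representation of $G$. Equivalently, it is the multiplicity of $\rho$ in $\theta\otimes_F\overline{F}$, where $\theta$ is the unique irreducible $F$-representation of $G$ such that $\rho$ is a constituent of $\theta\otimes_F\overline{F}$. Inertia subgroup: for an irreducible $F$-representation $\eta$ of a normal subgroup $K$ of $G$ and $g\in G$, let $\eta^g(h)=\eta(ghg^{-1})$ for $h\in K$. The inertia subgroup of $\eta$ in $G$ is the set of $g\in G$ such that $\eta^g$ is equivalent to $\eta$ over $F$. *)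

(* Defs.v *)
From HB Require Import structures.
From mathcomp Require Import all_boot all_order all_algebra all_fingroup.
From mathcomp Require Import all_solvable all_field all_character.

Set Implicit Arguments.
Unset Strict Implicit.
Unset Printing Implicit Defensive.

Import GroupScope GRing.Theory.
Local Open Scope ring_scope.

(* The trivial group has prime power order (k = 0). *)
Definition prime_power_order (gT : finGroupType) (K : {group gT}) : Prop :=
  exists p k : nat, prime p /\ #|K| = (p ^ k)%N.

Definition is_metabelian (gT : finGroupType) (G : {group gT}) : bool :=
  abelian G^`(1)%g.

(* For K normal in G, containing G' amounts to G / K being abelian. *)
Definition pp_max_abelian_normal (gT : finGroupType) (G K : {group gT}) : Prop :=
  [/\ [max K | K <| G & abelian K]%g,
      prime_power_order K
    & G^`(1)%g \subset K].

(* gcore H G is the intersection of the conjugates H :^ x for x in G. *)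
Definition core_free (gT : finGroupType) (G H : {group gT}) : bool :=
  gcore H G == 1%g.

Definition is_algebraic_closure (F : fieldType) (L : closedFieldType)
    (iota : {rmorphism F -> L}) : Prop :=
  forall z : L, algebraicOver iota z.

(* Membership in F(chi), the smallest subfield of L that contains the image of
   F and the values on G of the character chi of rho. *)
Definition in_character_field (F L : fieldType) (iota : {rmorphism F -> L})
    (gT : finGroupType) (G : {group gT}) (n : nat)
    (rho : mx_representation L G n) (z : L) : Prop :=
  forall S : {pred L}, divring_closed S ->
    (forall a : F, iota a \in S) ->
    (forall g : gT, g \in G -> \tr (rho g) \in S) ->
    z \in S.

(* An F(chi)-representation is a matrix representation over L all of whose
   entries lie in the subfield F(chi). *)
Definition multiple_realizable (F L : fieldType) (iota : {rmorphism F -> L})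
    (gT : finGroupType) (G : {group gT}) (n : nat)
    (rho : mx_representation L G n) (m : nat) : Prop :=
  exists (k : nat) (theta : mx_representation L G k),
    (forall g : gT, g \in G ->
       forall i j : 'I_k, in_character_field iota rho (theta g i j)) /\
    (forall g : gT, g \in G -> \tr (theta g) = \tr (rho g) *+ m).

(* m is the Schur index of rho with respect to F; unique by minimality. *)
Definition is_schur_index (F L : fieldType) (iota : {rmorphism F -> L})
    (gT : finGroupType) (G : {group gT}) (n : nat)
    (rho : mx_representation L G n) (m : nat) : Prop :=
  [/\ (0 < m)%N,
      multiple_realizable iota rho m
    & forall m' : nat, (0 < m')%N -> multiple_realizable iota rho m' ->
        (m <= m')%N].

Lemma conj_repr_subproof (F : fieldType) (gT : finGroupType) (K : {group gT})
    (n : nat) (eta : mx_representation F K n) (g : gT) (nKg : g \in 'N(K)%g) :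
  mx_repr K (fun h => eta (h ^ g^-1)%g).
Proof.
split=> [|x y Kx Ky]; first by rewrite conj1g repr_mx1.
by rewrite conjMg repr_mxM // memJ_norm // groupV.
Qed.

(* (h ^ g^-1)%g is g * h * g^-1. *)
Definition conj_repr (F : fieldType) (gT : finGroupType) (K : {group gT})
    (n : nat) (eta : mx_representation F K n) (g : gT) (nKg : g \in 'N(K)%g) :
  mx_representation F K n := MxRepresentation (conj_repr_subproof eta nKg).

(* I is the inertia subgroup of eta in G. The normalizer condition only serves
   to form the conjugate of eta; it is automatic when K is normal in G. *)
Definition is_inertia (F : fieldType) (gT : finGroupType) (G K : {group gT})
    (n : nat) (eta : mx_representation F K n) (I : {group gT}) : Prop :=
  forall g : gT, g \in I <->
    g \in G /\ exists nKg : g \in 'N(K)%g, mx_rsim (conj_repr eta nKg) eta.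

Definition faithful_irr (F : fieldType) (gT : finGroupType) (G : {group gT})
    (n : nat) (rG : mx_representation F G n) : Prop :=
  mx_irreducible rG /\ mx_faithful rG.

Definition corefree_irr (F : fieldType) (gT : finGroupType) (G K : {group gT})
    (n : nat) (eta : mx_representation F K n) : Prop :=
  mx_irreducible eta /\ core_free G (rker eta).

Definition cyclotomic_over (F : fieldType) (m : nat) : {poly F} :=
  map_poly (intr : int -> F) 'Phi_m.

(* Main.v *)
Require Import Defs.
From HB Require Import structures.
From mathcomp Require Import all_boot all_order all_algebra all_fingroup.
From mathcomp Require Import all_solvable all_field all_character.
From mathcomp Require Import zify ring.
From Stdlib Require Import Classical_Prop ClassicalEpsilon.

(* A maximal abelian normal subgroup K containing G' is self-centralizing, and the
   characters of K below a faithful irreducible representation are those with core-free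
   kernel. An element x of G maps such a character lam to a Galois conjugate over F if
   and only if x acts on K by h |-> h ^ c where c is the cyclotomic character of an
   element of Gal(F(zeta)/F), zeta of order p ^ n; these x form a group I that does not
   depend on lam.

   I acts semilinearly on the lam-eigenspace, over M = F(zeta), of an irreducible
   F-representation. By Galois descent this eigenspace is a line if and only if lam
   extends to a crossed homomorphism I -> M^*; as lam extends at least to a subgroup of
   index 2, the dimension is always 1 or 2, and it is the Schur index.

   To compare two characters lam and lam', one extends kappa = lam' / lam. If some c is
   not 1 mod p, a coboundary does it; if all c are 1 mod p (mod 4 when p = 2), then I/K
   is cyclic and the Tate cohomology of its action on Z/p^n vanishes; otherwise p = 2 and
   the obstruction is the sign kappa (g ^ 2) for an element g inverting K. But such a
   g ^ 2 is central of order at most 2 in G, so that lam and lam' agree on it. *)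

Set Implicit Arguments.
Unset Strict Implicit.
Unset Printing Implicit Defensive.

Import GroupScope GRing.Theory.

(** * The action of a cyclic group on Z/p^n *)

(** The prime 2 is the obstacle because the units modulo 2^n are not cyclic: the sign -1 splits off,
    and it alone can obstruct an extension.

    Representations are studied through the semilinear action of H x A on row vectors over M, where
    A is a Galois group. The stabilizer of lam there is the graph of a homomorphism from I to A with
    kernel K. Irreducibility over the base field makes the lam-eigenspace of least rank among the
    nonzero subspaces stable under I, and degrees and characters are computed from that rank.

    One treatment serves three base fields: F for the degrees, F(chi) for the Schur indices, and the
    closure for chi itself, which is induced from K. The Galois elements realized by G are exactly
    those that fix F(chi), so that I and its map to the Galois group are the same over F and over
    F(chi). A single obstruction therefore governs degrees and Schur indices alike.

    Core-freeness serves to promote identities between values of lam to identities in K. *)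

Section GeometricSums.
Local Open Scope nat_scope.

Definition gsum (c i : nat) := \sum_(k < i) c ^ k.

Lemma gsum1 c : gsum c 1 = 1.
Proof. by rewrite /gsum big_ord1. Qed.

Lemma gsumS c i : gsum c i.+1 = gsum c i + c ^ i.
Proof. by rewrite /gsum big_ord_recr. Qed.

Lemma gsumD c i j : gsum c (i + j) = gsum c i + c ^ i * gsum c j.
Proof.
rewrite /gsum big_split_ord /= big_distrr /=; congr (_ + _).
by apply: eq_bigr => k _; rewrite expnD.
Qed.

Lemma gsumM c i j : gsum c (i * j) = gsum c i * gsum (c ^ i) j.
Proof.
elim: j => [|j IHj]; first by rewrite muln0 /gsum !big_ord0 muln0.
by rewrite mulnS addnC gsumD IHj gsumS mulnDr -expnM [c ^ _ * _]mulnC.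
Qed.

Lemma expn_mod1 p c k : c = 1 %[mod p] -> c ^ k = 1 %[mod p].
Proof. by move=> c1; rewrite -modnXm c1 modnXm exp1n. Qed.

Lemma gsum_mod p c i : c = 1 %[mod p] -> gsum c i = i %[mod p].
Proof.
move=> c1; elim: i => [|i IHi]; first by rewrite /gsum big_ord0.
by rewrite gsumS -modnDm IHi expn_mod1 // modnDm addn1.
Qed.

Lemma gsum_eq_mod p c d i : c = d %[mod p] -> gsum c i = gsum d i %[mod p].
Proof.
move=> e; elim: i => [|i IHi]; first by rewrite /gsum !big_ord0.
by rewrite !gsumS -modnDm IHi -modnXm e modnXm modnDm.
Qed.

Lemma mod4_3 a : a = 3 %[mod 4] -> exists m, a = 2 * (2 * m + 1) + 1.
Proof.
move=> a3; exists (a %/ 4).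
rewrite {1}(divn_eq a 4) a3 (modn_small (isT : 3 < 4)); ring.
Qed.

(** The units on which lifting the exponent works; for p = 2 the sign has to be excluded, hence the
    modulus 4. *)
Definition near1 p c := (c == 1 %[mod p]) && ((p == 2) ==> (c == 1 %[mod 4])).

Lemma near1X p c k : near1 p c -> near1 p (c ^ k).
Proof.
case/andP=> /eqP c1 /implyP c4; apply/andP; split; first exact/eqP/expn_mod1.
by apply/implyP=> /c4/eqP c41; apply/eqP/expn_mod1.
Qed.

Lemma near1_gt0 p c : prime p -> near1 p c -> 0 < c.
Proof.
move=> pr_p /andP[+ _]; case: c => //; rewrite mod0n modn_small ?prime_gt1 //.
Qed.

Lemma expn_1D p t k : exists r, (1 + p * t) ^ k = 1 + k * (p * t) + p ^ 2 * r.
Proof.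
elim: k => [|k [r IHk]]; first by exists 0; rewrite expn0 mul0n muln0 !addn0.
exists (r + k * t ^ 2 + r * p * t); rewrite expnS IHk; ring.
Qed.

(** Modulo p^2 only the terms of degree at most 1 in c - 1 matter, and the linear one carries the
    sum of the k < p, a multiple of p when p is odd. For p = 2 the sum is 1 + c, which is 2 modulo
    4. *)
Lemma logn_gsum_p p c : prime p -> near1 p c -> logn p (gsum c p) = 1.
Proof.
move=> pr_p n1c; have c_gt0 := near1_gt0 pr_p n1c.
case/andP: n1c => c1 c4; have p_gt0 := prime_gt0 pr_p.
have div_p: p %| gsum c p by rewrite /dvdn (gsum_mod _ (eqP c1)) modnn.
suffices Ndiv: ~~ (p ^ 2 %| gsum c p).
  have gt0: 0 < gsum c p by case: posnP Ndiv => // ->; rewrite dvdn0.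
  rewrite pfactor_dvdn // -ltnNge ltnS in Ndiv.
  by apply/eqP; rewrite eqn_leq Ndiv -pfactor_dvdn.
have [p2 | p_odd] := even_prime pr_p.
  move: c4; rewrite p2 /= => /eqP c41; rewrite /gsum big_ord_recr big_ord1 /=.
  by rewrite expn0 expn1 /dvdn -modnDmr c41.
have /dvdnP[t Dc]: p %| c.-1 by rewrite -subn1 -eqn_mod_dvd.
have{Dc} Dc: c = 1 + p * t by rewrite mulnC -Dc add1n prednK.
have [r Dg]: exists r, gsum c p = p + (\sum_(k < p) k) * (p * t) + p ^ 2 * r.
  suff IH m: exists r, gsum c m = m + (\sum_(k < m) k) * (p * t) + p ^ 2 * r by [].
  rewrite Dc; elim: m => [|k [r IHk]].
    by exists 0; rewrite /gsum !big_ord0 mul0n muln0.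
  have [r' Dk] := expn_1D p t k; exists (r + r').
  by rewrite gsumS IHk Dk big_ord_recr /=; ring.
have /dvdnP[u Du]: p %| \sum_(k < p) k.
  rewrite -(big_mkord xpredT id) /= bin2_sum bin2odd //.
  by rewrite dvdn_mulr.
have ->: gsum c p = p + p ^ 2 * (u * t + r) by rewrite Dg Du; ring.
rewrite dvdn_addl; last exact: dvdn_mulr.
by rewrite gtnNdvd // -{1}[p]expn1 ltn_exp2l ?prime_gt1.
Qed.

(** Lifting the exponent: by [gsumM] each factor p of i contributes valuation one, and the part of i
    prime to p contributes nothing. *)
Lemma logn_gsum p c i : prime p -> near1 p c -> 0 < i -> logn p (gsum c i) = logn p i.
Proof.
move=> pr_p n1c i_gt0.
have unit_case d m : near1 p d -> ~~ (p %| m) -> ~~ (p %| gsum d m).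
  by case/andP=> d1 _; rewrite /dvdn (gsum_mod _ (eqP d1)).
have gsum_gt0 d m : 0 < m -> 0 < gsum d m.
  by case: m => // m _; rewrite /gsum big_ord_recl expn0.
have [m Npm ->] := pfactor_coprime pr_p i_gt0; move: (logn p i) => j.
rewrite prime_coprime // in Npm.
have m_gt0: 0 < m by case: m Npm => //; rewrite dvdn0.
have pX_gt0 k : 0 < p ^ k by rewrite expn_gt0 prime_gt0.
rewrite mulnC gsumM lognM ?gsum_gt0 // lognM // pfactorK //; congr (_ + _).
  elim: j => [|j IHj]; first by rewrite expn0 gsum1 logn1.
  rewrite expnSr gsumM lognM ?gsum_gt0 ?pX_gt0 ?prime_gt0 // IHj.
  by rewrite logn_gsum_p ?near1X ?addn1.
have logn0N x: ~~ (p %| x) -> logn p x = 0 by rewrite lognE => /negPf->; rewrite !andbF.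
by rewrite !logn0N // unit_case ?near1X.
Qed.

Lemma inv_mod u q : coprime u q -> exists u', u * u' = 1 %[mod q].
Proof.
case: (posnP u) => [-> | u_gt0].
  by rewrite /coprime gcd0n => /eqP->; exists 0; rewrite !modn1.
case/(coprimeP _ u_gt0) => [[x y] /= Dxy]; exists x.
have ->: u * x = 1 + y * q by lia.
by rewrite addnC modnMDl.
Qed.

Lemma solve_mod p n s a t : prime p -> 0 < a -> logn p a = s -> p ^ s %| t ->
  exists v, t = a * v %[mod p ^ n].
Proof.
move=> pr_p a_gt0 Ds /dvdnP[w ->]; have [u cpu Da] := pfactor_coprime pr_p a_gt0.
have /inv_mod[u' Du]: coprime u (p ^ n) by rewrite coprimeXr // coprime_sym.
exists (u' * w); rewrite Da Ds.
have ->: u * p ^ s * (u' * w) = (u * u') * (w * p ^ s) by ring.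
by rewrite -[RHS]modnMml Du modnMml mul1n.
Qed.

(* [gsum c b] and [c.-1] are the norm and the augmentation of a cyclic group of
   order [b = p ^ (n - s)] acting on Z/p^n through the powers of [c]; conditions 2
   and 3 state the vanishing of its odd and even Tate cohomology, and condition 4
   says that the powers of [c] are all the classes congruent to 1 modulo p^s. *)
Definition cyclic_action p n s c :=
  [/\ s <= n /\ p ^ s %| c.-1,
      forall t, p ^ n %| gsum c (p ^ (n - s)) * t ->
        exists v, t = c.-1 * v %[mod p ^ n],
      forall t, p ^ n %| c.-1 * t ->
        exists v, t = gsum c (p ^ (n - s)) * v %[mod p ^ n],
      forall t, t = 1 %[mod p ^ s] -> exists i, t = c ^ i %[mod p ^ n]
    & forall i, (c ^ i = 1 %[mod p ^ n]) <-> (p ^ (n - s) %| i)].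

Lemma cyclic_action1 p n : cyclic_action p n n 1.
Proof.
rewrite /cyclic_action subnn expn0 gsum1; split=> //.
- by move=> t; rewrite mul1n => q_t; exists 0; rewrite (eqP q_t) mod0n.
- by move=> t _; exists t; rewrite mul1n.
- by move=> t ->; exists 0.
by move=> i; rewrite exp1n dvd1n.
Qed.

(** All the conditions are valuation counts in c^i - 1 = (c - 1) (gsum c i), where the first factor
    has valuation s and the second that of i. *)
Lemma cyclic_action_near1 p n c : prime p -> near1 p c -> c <> 1 %[mod p ^ n] ->
  cyclic_action p n (logn p c.-1) c.
Proof.
move=> pr_p n1c cN1; set s := logn p _; have c_gt0 := near1_gt0 pr_p n1c.
have c1_gt0: 0 < c.-1.
  by case: posnP => // c1; case: cN1; rewrite -(prednK c_gt0) c1.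
have s_lt_n: s < n.
  by rewrite ltnNge -pfactor_dvdn // -subn1 -eqn_mod_dvd //; apply/eqP.
have q_gt0: 0 < p ^ n by rewrite expn_gt0 prime_gt0.
have b_gt0 k: 0 < p ^ k by rewrite expn_gt0 prime_gt0.
set b := p ^ (n - s); have Dq: p ^ n = p ^ s * b by rewrite -expnD subnKC // ltnW.
have lg_b: logn p (gsum c b) = n - s by rewrite logn_gsum ?b_gt0 // pfactorK.
have gb_gt0: 0 < gsum c b.
  by case: posnP lg_b => // ->; rewrite logn0; lia.
have pow1 i : (c ^ i = 1 %[mod p ^ n]) <-> (b %| i).
  case: (posnP i) => [-> | i_gt0]; first by rewrite dvdn0.
  have ->: (c ^ i = 1 %[mod p ^ n]) <-> p ^ n %| c.-1 * gsum c i.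
    by rewrite -predn_exp -subn1 -eqn_mod_dvd ?expn_gt0 ?c_gt0 //; split=> /eqP.
  have gi_gt0: 0 < gsum c i by case: (i) i_gt0 => // m _; rewrite /gsum big_ord_recl.
  rewrite pfactor_dvdn ?muln_gt0 ?c1_gt0 // lognM // logn_gsum // -/s.
  by rewrite /b pfactor_dvdn //; split; lia.
split=> //; first by rewrite pfactor_dvdnn ltnW.
- move=> t q_t; apply: (@solve_mod p n s) => //.
  have [->|t_gt0] := posnP t; first exact: dvdn0.
  move: q_t; rewrite !pfactor_dvdn ?muln_gt0 ?t_gt0 ?gb_gt0 // lognM // lg_b; lia.
- move=> t q_t; apply: (@solve_mod p n (n - s)) => //.
  have [->|t_gt0] := posnP t; first exact: dvdn0.
  move: q_t; rewrite !pfactor_dvdn ?muln_gt0 ?c1_gt0 // lognM // -/s; lia.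
move=> t t1.
have [y Dy]: exists y, t = 1 + c.-1 * y %[mod p ^ n].
  (* Adding p^n - 1 stands for subtracting 1. *)
  have [v Dv] : exists v, t + (p ^ n).-1 = c.-1 * v %[mod p ^ n].
    apply: (@solve_mod p n s) => //.
    rewrite /dvdn -modnDml t1 modnDml add1n prednK // Dq modnMr //.
  exists v; rewrite addnC -modnDml -Dv modnDml -addnA addn1 prednK //.
  by rewrite modnDr.
(* By counting, the sums [gsum c i] for i < b represent all classes modulo b, so that every 1 + (c -
   1) y is a power of c. *)
have inj: injective (fun i : 'I_b => Ordinal (ltn_pmod (gsum c i) (b_gt0 (n - s)))).
  move=> i j /(congr1 val) /= Eij; apply/val_inj => /=.
  wlog le_ij: i j Eij / i <= j.
    by move=> IH; case: (leqP i j) => [|/ltnW] /IH->.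
  apply/eqP; rewrite eqn_leq le_ij leqNgt; apply/negP=> lt_ij.
  have d_gt0: 0 < j - i by rewrite subn_gt0.
  have: b %| c ^ i * gsum c (j - i).
    have Dj: gsum c j = gsum c i + c ^ i * gsum c (j - i) by rewrite -gsumD subnKC.
    by rewrite -[_ * _](addKn (gsum c i)) -Dj -eqn_mod_dvd ?Eij // Dj leq_addr.
  have cop: coprime c p.
    by case/andP: n1c => /eqP c1 _; rewrite -coprime_modl c1 coprime_modl coprime1n.
  rewrite Gauss_dvdr; last by rewrite coprimeXl // coprimeXr // coprime_sym.
  have g_gt0: 0 < gsum c (j - i).
    by case: (j - i) d_gt0 => // m _; rewrite /gsum big_ord_recl.
  rewrite pfactor_dvdn // logn_gsum // -pfactor_dvdn // => /dvdn_leq-/(_ d_gt0).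
  by rewrite leqNgt (leq_ltn_trans (leq_subr _ _)).
have [g _ gK] := injF_bij inj.
pose i := g (Ordinal (ltn_pmod y (b_gt0 (n - s)))); exists i.
have /(congr1 val)/= Ei := gK (Ordinal (ltn_pmod y (b_gt0 (n - s)))).
rewrite -/i in Ei; rewrite Dy -[c ^ i]prednK ?expn_gt0 ?c_gt0 // predn_exp -add1n.
apply/eqP; rewrite eqn_modDl -/(gsum c i) eq_sym.
have /dvdnP[u ->]: p ^ s %| c.-1 by rewrite pfactor_dvdnn.
rewrite -!mulnA; apply/eqP; rewrite -modnMmr -[RHS]modnMmr; congr (_ * _ %% _).
by rewrite Dq -!muln_modr Ei.
Qed.

End GeometricSums.

(** * Extending characters to crossed homomorphisms *)

Section CrossedHomomorphisms.

Variables (gT : finGroupType) (M : fieldType).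
Implicit Types (K : {group gT}) (kappa : gT -> M).

Definition group_char K kappa :=
  kappa 1%g = 1%R /\ {in K &, {morph kappa : x y / (x * y)%g >-> (x * y)%R}}.

Lemma group_charX K kappa x i : group_char K kappa -> x \in K ->
  kappa (x ^+ i)%g = (kappa x ^+ i)%R.
Proof.
case=> k1 kM Kx; elim: i => [|i IHi]; first by rewrite expg0 expr0.
by rewrite expgS exprS kM ?groupX ?IHi.
Qed.

Lemma group_charV K kappa x : group_char K kappa -> x \in K ->
  kappa x^-1%g = ((kappa x)^-1)%R.
Proof.
case=> k1 kM Kx; have e: (kappa x * kappa x^-1%g)%R = 1%R.
  by rewrite -kM ?groupV // mulgV.
have nz: kappa x != 0%R by apply: contra_eq_neq e => ->; rewrite mul0r eq_sym oner_neq0.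
by apply: (mulfI nz); rewrite e mulfV.
Qed.

Variables (I K : {group gT}) (p n : nat) (c : gT -> nat) (zeta : M).
Hypotheses (pr_p : prime p) (prim_zeta : ((p ^ n)%N.-primitive_root zeta)%R).
Hypotheses (sKI : K \subset I) (abK : abelian K) (derI : [~: I, I]%g \subset K).
Hypotheses (expK : exponent K = (p ^ n)%N) (selfC : 'C_I(K)%g \subset K).
Hypothesis cP : forall x h, x \in I -> h \in K -> (h ^ x = h ^+ c x)%g.
Local Notation q := (p ^ n)%N.

Let q_gt0 : 0 < q. Proof. by rewrite expn_gt0 prime_gt0. Qed.

(** An abelian group has an element whose order is its exponent. *)
Lemma eq_exponent i j :
  {in K, forall h, h ^+ i = h ^+ j}%g <-> i = j %[mod q].
Proof.
split=> [eq_ij | eq_ij h Kh]; last first.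
  have dv: #[h]%g %| q by rewrite -expK dvdn_exponent.
  by apply/eqP; rewrite eq_expg_mod_order -(modn_dvdm i dv) eq_ij (modn_dvdm j dv).
have [x Kx ox] := exponent_witness (abelian_nil abK).
by apply/eqP; rewrite -expK ox -eq_expg_mod_order eq_ij.
Qed.

Lemma expr_eq_mod (u : M) i j :
  (u ^+ q = 1)%R -> i = j %[mod q] -> (u ^+ i = u ^+ j)%R.
Proof. by move=> uq eq_ij; rewrite -(expr_mod i uq) eq_ij expr_mod. Qed.

Lemma nKI : I \subset 'N(K)%g.
Proof. by rewrite -commg_subr (subset_trans _ derI) // commgSS. Qed.

Lemma expoM x y : x \in I -> y \in I -> c (x * y)%g = c x * c y %[mod q].
Proof.
move=> Ix Iy; apply/eq_exponent => h Kh.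
rewrite -cP ?groupM // conjgM (cP Ix) // cP ?groupX //.
by rewrite expgM.
Qed.

Lemma expo_in x : x \in I -> (x \in K) <-> c x = 1 %[mod q].
Proof.
move=> Ix; split=> [Kx | /eq_exponent cx1].
  apply/eq_exponent => h Kh; rewrite -cP // expg1.
  by apply/conjg_fixP/commgP/(centsP abK).
apply: (subsetP selfC); rewrite inE Ix; apply/centP => h Kh.
by apply/commute_sym/commgP/conjg_fixP; rewrite cP // cx1.
Qed.

Lemma expo1 : c 1%g = 1 %[mod q].
Proof. by apply/expo_in. Qed.

Lemma expoX x i : x \in I -> c (x ^+ i)%g = c x ^ i %[mod q].
Proof.
move=> Ix; elim: i => [|i IHi]; first by rewrite expg0 expo1.
by rewrite expgS expoM ?groupX // expnS -modnMmr IHi modnMmr.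
Qed.

Lemma expoV x : x \in I -> c x * c x^-1%g = 1 %[mod q].
Proof. by move=> Ix; rewrite -expoM ?groupV // mulgV expo1. Qed.

Lemma coprime_expo x : x \in I -> coprime (c x) q.
Proof.
by move/expoV=> e; move: (coprime1n q); rewrite -coprime_modl -e coprime_modl coprimeMl => /andP[].
Qed.

(** The 1-cocycles of J in the q-th roots of unity, on which y acts from the right as the power
    [c y]. *)
Definition crossed (J : {group gT}) (f : gT -> M) :=
  (forall x, x \in J -> f x ^+ q = 1)%R
  /\ (forall x y, x \in J -> y \in J -> f (x * y)%g = f x ^+ c y * f y)%R.

Variable kappa : gT -> M.
Hypothesis kapP : group_char K kappa.

Lemma kappa_root h : h \in K -> (kappa h ^+ q = 1)%R.
Proof.
by move=> Kh; rewrite -(group_charX q kapP Kh) -expK expg_exponent //; case: kapP.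
Qed.

Lemma kappaJ x h : x \in I -> h \in K -> kappa (h ^ x)%g = (kappa h ^+ c x)%R.
Proof. by move=> Ix Kh; rewrite cP // (group_charX _ kapP). Qed.

Lemma crossed_self : crossed K kappa.
Proof.
split=> [x /kappa_root // | x y Kx Ky]; case: (kapP) => _ ->//; congr (_ * _)%R.
rewrite -[LHS]expr1; apply: expr_eq_mod; first exact: kappa_root.
by apply/esym/expo_in => //; apply: (subsetP sKI).
Qed.

(** The assumption says that u inverts c g - 1. On K, commutation with g is the power map of
    exponent c g - 1, which u undoes; the identity [xy, g] = [x, g]^y [y, g] gives the cocycle
    rule. *)
Lemma crossed_unit g : g \in I -> (exists u, u * c g = u + 1 %[mod q]) ->
  exists2 f, crossed I f & {in K, f =1 kappa}.
Proof.
move=> Ig [u Du]; exists (fun x => kappa [~ x, g] ^+ u)%R.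
  have KR x : x \in I -> [~ x, g] \in K by move=> Ix; apply: (subsetP derI) (mem_commg Ix Ig).
  split=> [x Ix | x y Ix Iy]; first by rewrite exprAC kappa_root ?KR // expr1n.
  have [_ kM] := kapP.
  rewrite commMgJ kM ?KR // ?memJ_norm ?(subsetP nKI) ?KR //.
  by rewrite exprMn kappaJ ?KR // exprAC.
move=> k Kk /=; have Ik := subsetP sKI k Kk; have [_ kM] := kapP.
rewrite /commg kM ?groupV ?memJ_norm ?(subsetP nKI) // kappaJ // (group_charV kapP) //.
have nz: kappa k != 0%R.
  by apply: contra_eq_neq (kappa_root Kk) => ->; rewrite expr0n gtn_eqF // eq_sym oner_neq0.
rewrite exprMn -exprM mulnC (expr_eq_mod (kappa_root Kk) Du) exprVn exprD expr1.
by rewrite mulrA mulVf ?mul1r // expf_neq0.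
Qed.

(** * Extension when J/K is cyclic *)

Section Cyclic.

Variables (J : {group gT}) (x0 : gT) (s c0 : nat).
Hypotheses (sKJ : K \subset J) (sJI : J \subset I) (Jx0 : x0 \in J).
Hypotheses (c0_gt0 : 0 < c0) (Dc0 : c0 = c x0 %[mod q]).
Hypothesis genJ : forall x, x \in J -> exists i, (x0 ^- i * x \in K)%g.
Hypothesis cycJ : cyclic_action p n s c0.
Let b := (p ^ (n - s))%N.
Let Ix0 : x0 \in I. Proof. exact: (subsetP sJI). Qed.

Lemma x0_in i : ((x0 ^+ i)%g \in K) <-> (b %| i).
Proof.
have [_ _ _ _ <-] := cycJ; rewrite (expo_in (groupX i Ix0)) expoX //.
by rewrite -modnXm -Dc0 modnXm.
Qed.

(** Even Tate cohomology: an invariant root of unity is a norm. *)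
Lemma norm_fixed (u : M) t : (u ^+ c0 = u)%R -> (u = zeta ^+ t)%R ->
  exists v, (u = (zeta ^+ v) ^+ gsum c0 b)%R.
Proof.
move=> fix_u Du; have [_ _ H2 _ _] := cycJ.
have [|v Dv] := H2 t.
  rewrite mulnC -subn1 mulnBr muln1 -eqn_mod_dvd ?leq_pmulr //.
  by rewrite -(eq_prim_root_expr prim_zeta) exprM -Du fix_u.
by exists v; rewrite -exprM Du mulnC; apply/eqP; rewrite (eq_prim_root_expr prim_zeta); apply/eqP.
Qed.

(** Odd Tate cohomology, in the manner of Hilbert 90: a root of unity of norm 1 is a quotient v^c0 /
    v. *)
Lemma augmentation_solve (u : M) : (u ^+ q = 1)%R -> (u ^+ gsum c0 b = 1)%R ->
  exists v, (v ^+ q = 1 /\ v ^+ c0 = v * u)%R.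
Proof.
case/(prim_rootP prim_zeta) => t -> norm_t; have [_ H1 _ _ _] := cycJ.
have [|v Dv] := H1 t.
  by rewrite mulnC (prim_order_dvd prim_zeta) exprM norm_t.
exists (zeta ^+ v)%R; split; first by rewrite exprAC (prim_expr_order prim_zeta) expr1n.
rewrite -exprM -exprD; apply/eqP; rewrite (eq_prim_root_expr prim_zeta).
by rewrite -modnDmr Dv modnDmr mulnC -{2}[v]mul1n -mulnDl add1n prednK.
Qed.

(** A value w at x0 has to satisfy w^(gsum c0 b) = kappa (x0^b). The right-hand side is invariant
    because x0 commutes with x0^b, so it is a norm and w exists. *)
Lemma crossed_cyclic : exists2 f, crossed J f & {in K, f =1 kappa}.
Proof.
have Kb m : (x0 ^+ (b * m))%g \in K by apply/x0_in/dvdn_mulr.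
have Kb1 : (x0 ^+ b)%g \in K by rewrite -[b]muln1 Kb.
have kfix i m : (kappa (x0 ^+ (b * m)) ^+ (c0 ^ i)%N = kappa (x0 ^+ (b * m)))%R.
  have -> : (kappa (x0 ^+ (b * m)) ^+ (c0 ^ i)%N = kappa ((x0 ^+ (b * m)) ^ (x0 ^+ i)))%R.
    rewrite kappaJ ?(groupX i Ix0) ?Kb //; apply: expr_eq_mod; first exact: kappa_root.
    by rewrite expoX // -modnXm Dc0 modnXm.
  by congr kappa; apply/conjg_fixP/commgP/commuteX2.
have [w wq Dw]: exists2 w : M, (w ^+ q = 1)%R & (w ^+ gsum c0 b = kappa (x0 ^+ b))%R.
  have [t Dt] := prim_rootP prim_zeta (kappa_root Kb1).
  have [|v Dv] := norm_fixed _ Dt; last first.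
    by exists (zeta ^+ v)%R; rewrite ?Dv // exprAC (prim_expr_order prim_zeta) expr1n.
  by have:= kfix 1%N 1%N; rewrite muln1 expn1.
pose F i k := (w ^+ gsum c0 i * kappa k)%R.
have wbm m : (w ^+ gsum c0 (b * m) = kappa (x0 ^+ (b * m)))%R.
  rewrite gsumM exprM Dw expgM (group_charX m kapP Kb1).
  apply: expr_eq_mod; first exact: kappa_root.
  by apply: gsum_mod; case: cycJ => _ _ _ _ ->.
have [_ kM] := kapP.
have Feq i j k k' : k \in K -> k' \in K -> (x0 ^+ i * k = x0 ^+ j * k')%g -> F i k = F j k'.
  wlog le_ij: i j k k' / i <= j.
    by move=> IH Kk Kk' e; case/orP: (leq_total i j) => le_ij; [apply: IH | apply/esym/IH].
  move=> Kk Kk' e; have{e} Dk: (k = x0 ^+ (j - i) * k')%g.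
    by apply: (mulgI (x0 ^+ i)%g); rewrite e mulgA -expgD subnKC.
  have: (x0 ^+ (j - i))%g \in K by rewrite -(groupMr _ Kk') -Dk.
  case/x0_in/dvdnP=> m; rewrite mulnC => Dm; rewrite Dm in Dk.
  rewrite /F -(subnKC le_ij) Dm gsumD exprD mulnC exprM wbm kfix.
  by rewrite Dk kM // mulrA.
have FM i j k k' : k \in K -> k' \in K ->
    F (i + j) (k ^ (x0 ^+ j) * k')%g = (F i k ^+ (c0 ^ j)%N * F j k')%R.
  move=> Kk Kk'; have Ix0j := groupX j Ix0; rewrite /F kM ?memJ_norm ?(subsetP nKI) //.
  rewrite kappaJ // addnC gsumD exprD exprMn -exprM [(gsum c0 i * _)%N]mulnC.
  have ->: (kappa k ^+ c (x0 ^+ j) = kappa k ^+ (c0 ^ j)%N)%R.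
    apply: expr_eq_mod; first exact: kappa_root.
    by rewrite expoX // -[RHS]modnXm Dc0 modnXm.
  by ring.
(* Exponents below the order of x0 suffice, which makes the search finite; the default 0 is not
   reached on J. *)
pose ix x : nat := if [pick i : 'I_#[x0]%g | (x0 ^- i * x \in K)%g] is Some i then i else 0.
have ixP x : x \in J -> (x0 ^- ix x * x \in K)%g.
  move=> /genJ[i Ki]; rewrite /ix; case: pickP => //= noi.
  have := noi (Ordinal (ltn_pmod i (order_gt0 x0))).
  by rewrite /= expg_mod_order Ki.
have Dx x : (x = x0 ^+ ix x * (x0 ^- ix x * x))%g by rewrite mulKVg.
pose f x := F (ix x) (x0 ^- ix x * x)%g.
have fE i k : k \in K -> f (x0 ^+ i * k)%g = F i k.
  move=> Kk; apply: Feq => //; rewrite ?mulKVg //.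
  by apply: ixP; rewrite groupM ?groupX // (subsetP sKJ).
exists f; last first.
  move=> k Kk; rewrite -[k]mul1g -(expg0 x0) fE // /F /gsum big_ord0 expr0 mul1r.
  by rewrite expg0 mul1g.
split=> [x Jx | x y Jx Jy].
  by rewrite /f /F exprMn exprAC wq expr1n mul1r kappa_root ?ixP.
have [Kx Ky] := (ixP x Jx, ixP y Jy).
set i := ix x in Kx *; set j := ix y in Ky *.
set k := (_ * x)%g in Kx; set k' := (_ * y)%g in Ky.
have Ex: (x = x0 ^+ i * k)%g := Dx x; have Ey: (y = x0 ^+ j * k')%g := Dx y.
have fxE: f x = F i k by []; have fyE: f y = F j k' by [].
clearbody i j k k'.
have Exy: (x * y = x0 ^+ (i + j) * (k ^ (x0 ^+ j) * k'))%g.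
  by rewrite Ex Ey expgD conjgE !mulgA mulgK.
rewrite Exy fE; last by rewrite groupM // memJ_norm // (subsetP nKI) ?groupX.
rewrite FM // fxE fyE; congr (_ * _)%R; apply: expr_eq_mod.
  by rewrite /F exprMn exprAC wq expr1n mul1r kappa_root.
rewrite [in RHS]Ey expoM ?groupX //; last exact: (subsetP sKI).
rewrite -modnMmr (proj1 (expo_in _) Ky) ?(subsetP sKI) // modnMmr muln1.
by rewrite expoX // -modnXm Dc0 modnXm.
Qed.

End Cyclic.

Lemma crossedX (J : {group gT}) f x i : J \subset I -> crossed J f -> x \in J ->
  f (x ^+ i)%g = (f x ^+ gsum (c x) i)%R.
Proof.
move=> sJI [fq fM] Jx; have Ix := subsetP sJI x Jx.
elim: i => [|i IHi].
  have := fM 1%g 1%g (group1 J) (group1 J); rewrite mulg1 expg0 /gsum big_ord0 expr0.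
  rewrite (expr_eq_mod (fq _ (group1 J)) expo1) expr1 -{1}[f 1%g]mulr1 => /mulfI-> //.
  by apply: contra_eq_neq (fq _ (group1 J)) => ->; rewrite expr0n gtn_eqF // eq_sym oner_neq0.
rewrite expgS fM ?groupX // IHi (expr_eq_mod (fq _ Jx) (expoX i Ix)).
by rewrite -exprD addnC gsumS.
Qed.

Lemma crossed_eq (J : {group gT}) x0 f1 f2 : J \subset I -> K \subset J -> x0 \in J ->
    (forall x, x \in J -> exists i, (x0 ^- i * x \in K)%g) ->
    crossed J f1 -> crossed J f2 -> f1 x0 = f2 x0 -> {in K, f1 =1 f2} ->
  {in J, f1 =1 f2}.
Proof.
move=> sJI sKJ Jx0 genJ f1P f2P f12x f12K x Jx; have [i Ki] := genJ x Jx.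
have Ji: (x0 ^- i * x)%g \in J by rewrite (subsetP sKJ).
rewrite -(mulKVg (x0 ^+ i)%g x); case: (f1P) (f2P) => [_ f1M] [_ f2M].
have Jx0i := groupX i Jx0; rewrite f1M // f2M //.
by rewrite (crossedX _ sJI f1P Jx0) (crossedX _ sJI f2P Jx0) f12x f12K.
Qed.

Lemma crossed_div (J : {group gT}) f1 f2 : crossed J f1 -> crossed J f2 ->
  crossed J (fun x => f1 x / f2 x)%R.
Proof.
move=> [f1q f1M] [f2q f2M]; split=> [x Jx | x y Jx Jy].
  by rewrite expr_div_n f1q // f2q // divr1.
by rewrite f1M ?f2M // expr_div_n mulf_div.
Qed.

Lemma crossed_coboundary (J : {group gT}) (v : M) : J \subset I -> (v ^+ q = 1)%R ->
  crossed J (fun x => v ^+ c x / v)%R.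
Proof.
move=> sJI vq; have nz : v != 0%R.
  by apply: contra_eq_neq vq => ->; rewrite expr0n gtn_eqF // eq_sym oner_neq0.
split=> [x Jx | x y Jx Jy]; first by rewrite expr_div_n exprAC vq expr1n divr1.
have [Ix Iy] := (subsetP sJI x Jx, subsetP sJI y Jy).
rewrite (expr_eq_mod vq (expoM Ix Iy)) expr_div_n -exprM.
by rewrite mulrA divfK // expf_neq0.
Qed.

Lemma expoJ x g : x \in I -> g \in I -> c (x ^ g^-1)%g = c x %[mod q].
Proof.
move=> Ix Ig; rewrite conjgE invgK expoM ?groupM ?groupV // -modnMmr expoM ?groupV //.
by rewrite modnMmr mulnCA -modnMmr expoV // modnMmr muln1.
Qed.

Lemma crossed_conj (J : {group gT}) f g : J \subset I -> g \in I ->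
    {in J, forall x, x ^ g^-1 \in J}%g -> crossed J f ->
  crossed J (fun x => f (x ^ g^-1)%g ^+ c g)%R.
Proof.
move=> sJI Ig nJg [fq fM]; split=> [x Jx | x y Jx Jy].
  by rewrite exprAC fq ?nJg // expr1n.
rewrite conjMg fM ?nJg //.
rewrite (expr_eq_mod (fq _ (nJg x Jx)) (expoJ (subsetP sJI y Jy) Ig)) exprMn.
by rewrite exprAC.
Qed.

Lemma root_neq0 (u : M) : (u ^+ q = 1)%R -> u != 0%R.
Proof. by apply: contra_eq_neq => ->; rewrite expr0n gtn_eqF // eq_sym oner_neq0. Qed.

(** * Extension across a subgroup of index two *)

Section IndexTwo.

Variables (J : {group gT}) (g : gT) (f : gT -> M) (v : M).
Hypotheses (sJI : J \subset I) (Ig : g \in I) (Jg : g \notin J).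
Hypothesis index2 : forall x y, x \in I -> x \notin J -> y \in I -> y \notin J -> (x * y)%g \in J.
Hypotheses (fP : crossed J f) (vq : (v ^+ q = 1)%R).
Hypothesis fJg : forall x, x \in J -> (f (x ^ g^-1)%g ^+ c g / f x = v ^+ c x / v)%R.
Hypothesis fgg : (f (g * g)%g = v ^+ c g * v)%R.

Lemma index2_norm x : x \in J -> (x ^ g^-1)%g \in J.
Proof.
move=> Jx; have Ix := subsetP sJI x Jx; rewrite conjgE invgK.
by apply: index2 => //; [rewrite groupM ?groupV | rewrite groupMl ?groupV].
Qed.

(* F (x g) = f x ^ c(g) v; the last two hypotheses are F (g x) = F ((g x g^-1) g) and
   F (g g) = f (g g). *)
Lemma crossed_index2_ext : exists2 F, crossed I F & {in J, F =1 f}.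
Proof.
have [fq fM] := fP; have nz_v := root_neq0 vq.
pose F y := if y \in J then f y else (f (y * g^-1)%g ^+ c g * v)%R.
have FJ: {in J, F =1 f} by move=> x Jx; rewrite /F Jx.
have FJg x : x \in J -> F (x * g)%g = (f x ^+ c g * v)%R.
  by move=> Jx; rewrite /F groupMl // (negPf Jg) mulgK.
have key x : x \in J -> (f (x ^ g^-1)%g ^+ c g * v = v ^+ c x * f x)%R.
  move=> Jx; apply/eqP; rewrite -eqr_div ?root_neq0 ?fq //.
    by rewrite fJg.
exists F => //; have sIJ x : x \in I -> x \in J \/ exists2 y, y \in J & x = (y * g)%g.
  move=> Ix; case: (boolP (x \in J)) => Jx; [by left | right].
  by exists (x * g^-1)%g; rewrite ?mulgKV // index2 ?groupV.
split=> [x /sIJ[Jx | [y Jy ->]] | x y].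
- by rewrite FJ ?fq.
- by rewrite FJg // exprMn exprAC fq // expr1n vq mulr1.
case/sIJ=> [Jx | [{}x Jx ->]] /sIJ[Jy | [{}y Jy ->]].
- by rewrite !FJ ?groupM ?fM.
- rewrite mulgA (FJ x Jx) !FJg ?(groupM Jx Jy) // fM // exprMn -exprM mulrA.
  by rewrite (expr_eq_mod (fq x Jx) (expoM (subsetP sJI y Jy) Ig)).
- have Jy' := index2_norm Jy.
  have ->: (x * g * y = x * y ^ g^-1 * g)%g by rewrite conjgE invgK !mulgA mulgKV.
  rewrite !FJg ?(groupM Jx Jy') // (FJ y Jy) fM //.
  rewrite (expr_eq_mod (fq x Jx) (expoJ (subsetP sJI y Jy) Ig)).
  by rewrite exprMn -mulrA key // exprMn -!exprM mulrA [(c g * _)%N]mulnC.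
have [Jy' Jgg] := (index2_norm Jy, index2 Ig Jg Ig Jg).
have ->: (x * g * (y * g) = x * y ^ g^-1 * (g * g))%g.
  by rewrite conjgE invgK !mulgA mulgKV.
have [Ix Iy] := (subsetP sJI x Jx, subsetP sJI y Jy).
rewrite !FJg // (FJ _ (groupM (groupM Jx Jy') Jgg)) 
  (fM _ _ (groupM Jx Jy') Jgg) (fM _ _ Jx Jy') fgg.
rewrite (expr_eq_mod (fq x Jx) (expoJ Iy Ig)) (expr_eq_mod _ (expoM Ig Ig)); last first.
  by rewrite exprMn exprAC !fq // expr1n mulr1.
rewrite (expr_eq_mod _ (expoM Iy Ig)); last first.
  by rewrite exprMn exprAC fq // expr1n vq mulr1.
have e : (f (y ^ g^-1)%g ^+ (c g * c g) * v ^+ c g = v ^+ (c y * c g) * f y ^+ c g)%R.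
  by rewrite !exprM -!exprMn key.
rewrite !exprMn -!exprM.
transitivity (f x ^+ (c y * (c g * c g)) * (f (y ^ g^-1)%g ^+ (c g * c g) * v ^+ c g) * v)%R.
  by rewrite !mulrA.
by rewrite e mulnCA !mulrA.
Qed.

End IndexTwo.

(** An element x0 outside K for which c x0 - 1 has least p-adic valuation s generates J modulo K:
    every other exponent is 1 modulo p^s, hence a power of c x0. If J = K, the trivial action with s
    = n is used. *)
Lemma cyclic_generator (J : {group gT}) : K \subset J -> J \subset I ->
    {in J, forall x, near1 p (c x)} ->
  exists x0 s c0,
    [/\ x0 \in J, 0 < c0, c0 = c x0 %[mod q],
        (forall x, x \in J -> exists i, (x0 ^- i * x \in K)%g)
      & cyclic_action p n s c0].
Proof.
move=> sKJ sJI near1J; have [sJK | ] := boolP (J \subset K).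
  exists 1%g, n, 1%N; split=> //; first by rewrite expo1.
    by move=> x /(subsetP sJK) Kx; exists 0%N; rewrite expg0 invg1 mul1g.
  exact: cyclic_action1.
case/subsetPn=> x1 Jx1 Kx1; have x1P: x1 \in J :\: K by rewrite inE Kx1.
case: (arg_minnP (fun x => logn p (c x).-1) x1P) => x0 /setDP[Jx0 Kx0] min_x0.
have Ix0 := subsetP sJI _ Jx0; have cN1 : c x0 <> 1 %[mod q] by move/(expo_in Ix0); apply/negP.
have cyc := cyclic_action_near1 pr_p (near1J _ Jx0) cN1.
exists x0, (logn p (c x0).-1), (c x0); split=> //.
  exact: near1_gt0 pr_p (near1J _ Jx0).
move=> x Jx; have [Kx | Kx] := boolP (x \in K).
  by exists 0%N; rewrite expg0 invg1 mul1g.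
have Ix := subsetP sJI _ Jx; have cx_gt0 := near1_gt0 pr_p (near1J _ Jx).
have cxN1: c x <> 1 %[mod q] by move/(expo_in Ix); apply/negP.
have cx1_gt0: 0 < (c x).-1.
  by case: posnP => // cx1; case: cxN1; rewrite -(prednK cx_gt0) cx1.
have [_ _ _ pow _] := cyc; have [|i Di] := pow (c x).
  apply/eqP; rewrite eqn_mod_dvd // subn1 pfactor_dvdn // min_x0 //.
  exact/setDP.
have Ixi := groupX i Ix0.
exists i; apply/expo_in; rewrite ?groupM ?groupV //.
rewrite expoM ?groupV // -modnMmr Di modnMmr -modnMmr -(expoX i Ix0) modnMmr.
by rewrite mulnC expoV.
Qed.

Lemma eq_mod4 x y : p = 2 -> 1 < n -> x = y %[mod q] -> x = y %[mod 4].
Proof.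
move=> Dp n_gt1 exy; have dv4: (4 %| q)%N by rewrite Dp; apply: (@dvdn_exp2l 2 2).
by rewrite -(modn_dvdm x dv4) exy modn_dvdm.
Qed.

Lemma expo_mod4 x : p = 2 -> 1 < n -> x \in I -> ~~ near1 2 (c x) -> c x = 3 %[mod 4].
Proof.
move=> Dp n_gt1 Ix; have oddc: odd (c x).
  have:= coprime_expo Ix; rewrite Dp coprime_sym coprime_pexpl ?(ltnW n_gt1) //.
  by rewrite coprime2n.
rewrite /near1 /= -(modn_dvdm (c x) (isT : 2 %| 4)%N).
have := oddc; rewrite -[odd _](@odd_mod _ 4) //.
by have := ltn_pmod (c x) (isT : 0 < 4); case: (c x %% 4)%N => [|[|[|[|]]]].
Qed.

Lemma near1_expoM x y : p = 2 -> 1 < n -> x \in I -> y \in I ->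
  ~~ near1 2 (c x) -> ~~ near1 2 (c y) -> near1 2 (c (x * y)%g).
Proof.
move=> Dp n_gt1 Ix Iy Jx Jy; rewrite /near1 /=.
have e: c (x * y)%g = 1 %[mod 4].
  rewrite (eq_mod4 Dp n_gt1 (expoM Ix Iy)) -modnMml expo_mod4 // modnMml.
  by rewrite -modnMmr expo_mod4 // modnMmr.
by rewrite -(modn_dvdm (c _) (isT : 2 %| 4)%N) e.
Qed.

(** The class of -a, represented by [q.-1 * a], is 1 modulo p^s and hence a power of c0. *)
Lemma exists_minus1_power (s c0 a : nat) : cyclic_action p n s c0 -> a + 1 = 0 %[mod p ^ s] ->
  exists i, c0 ^ i + a = 0 %[mod q].
Proof.
move=> [[le_sn _] _ _ pow _] a1; have dv: (p ^ s %| q)%N by rewrite dvdn_exp2l.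
have [|i Di] := pow (q.-1 * a)%N; last first.
  exists i; rewrite -modnDml -Di modnDml -mulSnr prednK // mod0n.
  by rewrite modnMr.
apply/eqP; rewrite -(eqn_modDr a) -mulSnr prednK // addnC a1 mod0n.
by apply: dvdn_mulr.
Qed.

Lemma inverting_expo g : g \in I -> c g + 1 = 0 %[mod q] -> {in K, forall h, h ^ g = h^-1}%g.
Proof.
move=> Ig cg h Kh; apply: (mulIg h); rewrite mulVg cP // -expgSr -addn1.
by rewrite (proj2 (eq_exponent _ _) cg).
Qed.

(** The second case is that of an exponent equal to 3 modulo 4. The modulus 4 is meaningful only if
    4 divides q, hence 1 < n; for q = 2 all units modulo q are 1 and I = K. *)
Lemma crossed_dichotomy :
     (exists2 f, crossed I f & {in K, f =1 kappa})
  \/ [/\ p = 2, 1 < n & exists2 J : {group gT},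
          [/\ K \subset J, J \subset I & J =i [pred x in I | near1 2 (c x)]]
        & exists2 g, g \in I & g \notin J].
Proof.
have trivialI: I \subset K -> exists2 f, crossed I f & {in K, f =1 kappa}.
  move=> sIK; have eIK: I = K by apply/val_inj/eqP; rewrite eqEsubset sIK.
  by exists kappa => //; rewrite eIK; apply: crossed_self.
have near1_mod x y : 0 < n -> (p = 2 -> 1 < n) -> x = y %[mod q] -> near1 p x = near1 p y.
  move=> n_gt0 n_gt1 exy; have dvp: (p %| q)%N by rewrite dvdn_exp.
  rewrite /near1 -(modn_dvdm x dvp) exy modn_dvdm //; congr (_ && _).
  case: eqP => //= Dp; have dv4: (4 %| q)%N by rewrite Dp; apply: (@dvdn_exp2l 2 2); apply: n_gt1.
  by rewrite -(modn_dvdm x dv4) exy modn_dvdm.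
have [n0 | n_gt0] := posnP n.
  by left; apply: trivialI; apply/subsetP=> x Ix; apply/expo_in; rewrite // n0 !modn1.
(* An exponent that is not 1 modulo p makes c g - 1 a unit modulo q; [c g + q.-1] represents that
   difference. *)
case: (pickP [pred g in I | c g != 1 %[mod p]]) => [g /andP[Ig cg] | all1].
  left; apply: (crossed_unit Ig); have cop_d : coprime (c g + q.-1) q.
    rewrite coprimeXr // coprime_sym prime_coprime //; apply: contra cg => dv.
    have dvq: (p %| q)%N by apply: dvdn_exp.
    have e: (c g + q = c g + q.-1 + 1)%N by rewrite -addnA addn1 prednK.
    have ->: c g = c g + q %[mod p] by rewrite -modnDmr (eqP dvq) addn0.
    by rewrite e -modnDml (eqP dv).
  have [u Du] := inv_mod cop_d; exists u; apply/eqP.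
  rewrite -(eqn_modDr (u * q.-1)%N) -mulnDr mulnC Du addnAC -mulnS prednK //.
  by rewrite modnMDl.
have cp1 x : x \in I -> c x = 1 %[mod p].
  by move=> Ix; have := all1 x; rewrite inE Ix => /negbFE/eqP.
have [/andP[/eqP Dp n1] | n_gt1] := boolP ((p == 2) && (n == 1%N)).
  left; apply: trivialI; apply/subsetP=> x Ix; apply/expo_in => //.
  by rewrite (eqP n1) expn1 cp1.
have n2 : p = 2 -> 1 < n.
  by move=> Dp; rewrite ltn_neqAle eq_sym n_gt0 andbT; apply: contra n_gt1 => ->; rewrite Dp eqxx.
pose Js := [set x in I | near1 p (c x)].
have Jgroup: group_set Js.
  apply/group_setP; split=> [|x y].
    by rewrite inE group1 (near1_mod _ _ n_gt0 n2 expo1) // /near1 eqxx implybT.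
  rewrite !inE => /andP[Ix /andP[/eqP x1 /implyP x4]] /andP[Iy /andP[/eqP y1 /implyP y4]].
  rewrite groupM // (near1_mod _ _ n_gt0 n2 (expoM Ix Iy)) //.
  rewrite /near1 -modnMml x1 modnMml mul1n y1 eqxx.
  apply/implyP=> p2; move/eqP: (x4 p2) (y4 p2) => {}x4 /eqP y4'.
  by rewrite -modnMml x4 modnMml mul1n y4'.
pose J := Group Jgroup.
have sKJ: K \subset J.
  apply/subsetP=> x Kx; have Ix := subsetP sKI x Kx; rewrite inE Ix.
  by rewrite (near1_mod _ _ n_gt0 n2 (proj1 (expo_in Ix) Kx)) // /near1 !eqxx implybT.
have sJI: J \subset I by apply/subsetP=> x; rewrite inE => /andP[].
have [sIJ | ] := boolP (I \subset J).
  have eIJ: I = J by apply/val_inj/eqP; rewrite eqEsubset sIJ.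
  have [x0 [s [c0 [Jx0 c0_gt0 Dc0 genJ cyc]]]] : exists x0 s c0,
    [/\ x0 \in J, 0 < c0, c0 = c x0 %[mod q],
        (forall x, x \in J -> exists i, (x0 ^- i * x \in K)%g)
      & cyclic_action p n s c0].
    by apply: cyclic_generator => // x; rewrite inE => /andP[].
  left; rewrite {1}eIJ; exact: (crossed_cyclic sKJ sJI Jx0 c0_gt0 Dc0 genJ cyc).
case/subsetPn=> g Ig Jg; have [Dp | pN2] := eqVneq p 2.
  right; split=> //; first exact: n2.
  by exists J; [split=> // x; rewrite !inE Dp | exists g].
by case/negP: Jg; rewrite inE Ig /near1 cp1 // eqxx (negPf pN2).
Qed.

(** Bounds the obstruction for an arbitrary kappa: the extension always exists on the part J of
    exponents near 1, and a product of two exponents equal to 3 modulo 4 falls back into J. *)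
Lemma crossed_index2 : exists (J : {group gT}) (f : gT -> M),
  [/\ K \subset J, J \subset I, crossed J f, {in K, f =1 kappa}
    & forall x y, x \in I -> x \notin J -> y \in I -> y \notin J -> (x * y)%g \in J].
Proof.
have [[f fP fK] | [Dp n_gt1 [J [sKJ sJI DJ] _]]] := crossed_dichotomy.
  by exists I, f; split=> // x y Ix /negP[].
have near1J: {in J, forall x, near1 p (c x)}.
  by move=> x; rewrite DJ inE Dp => /andP[].
have [x0 [s [c0 [Jx0 c0_gt0 Dc0 genJ cyc]]]] := cyclic_generator sKJ sJI near1J.
have [f fP fK] := crossed_cyclic sKJ sJI Jx0 c0_gt0 Dc0 genJ cyc.
exists J, f; split=> // x y Ix + Iy.
by rewrite !DJ !inE Ix Iy groupM //; apply: near1_expoM.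
Qed.

(** This is also necessary: as c g + 1 is 0 modulo q, an extension f satisfies f (g g) = (f g)^(c g
    + 1) = 1. *)
Hypothesis inverting : forall g, g \in I ->
  {in K, forall h, h ^ g = h^-1}%g -> kappa (g * g)%g = 1%R.

(* J has index 2 in I. Extending f to I amounts to choosing a solution v of fJg up to
   the roots of unity w fixed by J, and T = f (g g) / v ^ (c g + 1) is a sign. If no
   element of I inverts K, then -1 = w ^ (c g + 1) for some such w. *)
Lemma crossed_p2 (J : {group gT}) g0 : p = 2 -> 1 < n -> K \subset J -> J \subset I ->
    J =i [pred x in I | near1 2 (c x)] -> g0 \in I -> g0 \notin J ->
  exists2 f, crossed I f & {in K, f =1 kappa}.
Proof.
move=> Dp n_gt1 sKJ sJI DJ Ig0 Jg0.
have c4 x y: x = y %[mod q] -> x = y %[mod 4] by apply: eq_mod4.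
have c3 x : x \in I -> x \notin J -> c x = 3 %[mod 4].
  by move=> Ix; rewrite DJ inE Ix; apply: expo_mod4.
have index2 x y : x \in I -> x \notin J -> y \in I -> y \notin J -> (x * y)%g \in J.
  by move=> Ix + Iy; rewrite !DJ !inE Ix Iy groupM //; apply: near1_expoM.
have near1J: {in J, forall x, near1 p (c x)}.
  by move=> x; rewrite DJ inE Dp => /andP[].
have [x0 [s [c0 [Jx0 c0_gt0 Dc0 genJ cyc]]]] := cyclic_generator sKJ sJI near1J.
have [f fP fK] := crossed_cyclic sKJ sJI Jx0 c0_gt0 Dc0 genJ cyc.
have Ix0 := subsetP sJI _ Jx0.
have sol_g g : g \in I -> g \notin J ->
   exists u, [/\ u ^+ q = 1, (f (g * g)%g / (u ^+ c g * u)) ^+ 2 = 1 &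
    forall w, w ^+ q = 1 -> w ^+ c0 = w -> f (g * g)%g = (u * w) ^+ c g * (u * w) ->
     exists2 F, crossed I F & {in K, F =1 kappa}]%R.
  (* D compares f with its conjugate by g. It is trivial on K, so its value at x0 has norm 1, and D
     is the coboundary of some v. *)
  move=> Ig Jg; pose D x := (f (x ^ g^-1)%g ^+ c g / f x)%R.
  have nJg x : x \in J -> (x ^ g^-1)%g \in J by apply: (index2_norm sJI Ig Jg index2).
  have DP: crossed J D by apply: crossed_div => //; apply: crossed_conj.
  have [fq fM] := fP.
  have DK k : k \in K -> D k = 1%R.
    move=> Kk; have Kk' : (k ^ g^-1)%g \in K by rewrite memJ_norm // (subsetP nKI) ?groupV.
    rewrite /D !fK // -kappaJ // -conjgM mulVg conjg1 divff //.
    by rewrite root_neq0 ?kappa_root.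
  have Dx0q: (D x0 ^+ q = 1)%R by case: DP => ->.
  have [|v [vq Dv]] := augmentation_solve c0_gt0 cyc Dx0q.
    rewrite (expr_eq_mod Dx0q (gsum_eq_mod _ Dc0)) -(crossedX _ sJI DP Jx0).
    by apply: DK; apply/(x0_in sJI Jx0 Dc0 cyc).
  have nz_v := root_neq0 vq; have Jgg := index2 _ _ Ig Jg Ig Jg.
  have final w : (w ^+ q = 1)%R -> (w ^+ c0 = w)%R ->
      f (g * g)%g = ((v * w) ^+ c g * (v * w))%R ->
      exists2 F, crossed I F & {in K, F =1 kappa}.
    move=> wq wc0 fgg; have vwq: ((v * w) ^+ q = 1)%R by rewrite exprMn vq wq mul1r.
    have fJg x : x \in J -> (f (x ^ g^-1)%g ^+ c g / f x = (v * w) ^+ c x / (v * w))%R.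
      apply: (crossed_eq sJI sKJ Jx0 genJ DP (crossed_coboundary sJI vwq)).
        rewrite -(expr_eq_mod vwq Dc0) exprMn Dv wc0.
        by apply: (mulIf (root_neq0 vwq)); rewrite divfK ?root_neq0 //; ring.
      move=> k Kk; rewrite DK // (expr_eq_mod vwq (proj1 (expo_in _) Kk)) ?(subsetP sKI) //.
      by rewrite expr1 divff // root_neq0.
    have [F FP FJ] := crossed_index2_ext sJI Ig Jg index2 fP vwq fJg fgg.
    by exists F => // k Kk; rewrite FJ ?(subsetP sKJ) // fK.
  exists v; split=> //.
  set T := (f _ / _)%R; have nzden: (v ^+ c g * v != 0)%R by rewrite mulf_neq0 ?expf_neq0.
  have Tq: (T ^+ q = 1)%R.
    by rewrite expr_div_n fq // exprMn exprAC vq expr1n mulr1 divr1.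
  (* Evaluating D = coboundary of v at g g, which commutes with g, shows that T is invariant under
     g. *)
  have T_fix: (T ^+ c g = T)%R.
    have: (f (g * g)%g ^+ c g * v = v ^+ c (g * g)%g * f (g * g)%g)%R.
      have ggJ : ((g * g) ^ g^-1 = g * g)%g by rewrite conjgE invgK !mulgA mulgK.
      have Dgg: (D (g * g)%g = v ^+ c (g * g)%g / v)%R.
        apply: (crossed_eq sJI sKJ Jx0 genJ DP (crossed_coboundary sJI vq)) => //.
          by rewrite -(expr_eq_mod vq Dc0) Dv mulrAC mulfV ?mul1r.
        move=> k Kk; rewrite DK // (expr_eq_mod vq (proj1 (expo_in _) Kk)) ?(subsetP sKI) //.
        by rewrite expr1 divff.
      by apply/eqP; rewrite -eqr_div ?root_neq0 ?fq // -Dgg /D ggJ.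
    rewrite (expr_eq_mod vq (expoM Ig Ig)) => e.
    apply: (mulIf (mulf_neq0 nz_v (mulf_neq0 (expf_neq0 (c g * c g) nz_v) (expf_neq0 (c g) nz_v)))).
    rewrite /T expr_div_n exprMn -exprM.
    have nz2 := expf_neq0 (c g * c g) nz_v; have nz1 := expf_neq0 (c g) nz_v.
    transitivity (f (g * g)%g ^+ c g * v)%R; first by field; rewrite nz1 nz2.
    by rewrite e; field; rewrite nz_v nz1.
  (* c g - 1 is twice an odd number and the order of T is a power of 2, so invariance gives T^2 =
     1. *)
  have [m Dm] := mod4_3 (c3 g Ig Jg).
  have [m' Dm'] : exists m', (2 * m + 1) * m' = 1 %[mod q].
    by apply: inv_mod; rewrite Dp coprimeXr // coprimen2 oddD oddM.
  have T2m: (T ^+ (2 * (2 * m + 1)) = 1)%R.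
    have nzT: T != 0%R by rewrite root_neq0.
    by apply: (mulIf nzT); rewrite -exprSr -addn1 -Dm T_fix mul1r.
  have T2q : ((T ^+ 2) ^+ q = 1)%R by rewrite exprAC Tq expr1n.
  by rewrite -[LHS]expr1 -(expr_eq_mod T2q Dm') -exprM mulnA exprM T2m expr1n.
have oddq: (0 < n)%N by apply: ltnW.
(* If g inverts K, then v^(c g + 1) = 1 for every root of unity v, and f (g g) = kappa (g g) = 1: no
   sign remains. *)
case: (pickP [pred g in I | c g + 1 == 0 %[mod q]]) => [g /andP[Ig /eqP cg] | no_inv].
  have Jg: g \notin J.
    apply/negP=> Jg; have:= near1J g Jg; rewrite Dp /near1 /= => /andP[_ /eqP cg1].
    by have:= c4 _ _ cg; rewrite -modnDml cg1.
  have [v [vq _ final]] := sol_g g Ig Jg.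
  have ggK : (g * g)%g \in K.
    apply/expo_in; first exact: groupM.
    have q1 : (c g * c g + (c g + 1) = c g * (c g + 1) + 1)%N by ring.
    rewrite expoM //; apply/eqP; rewrite -(eqn_modDr (c g + 1)) q1 -modnDml -modnMmr cg.
    rewrite modnMmr muln0 mod0n.
    by rewrite add0n -modnDmr cg modnDmr addn0.
  apply: (final 1%R); rewrite ?expr1n // mulr1 -exprSr -addn1 (expr_eq_mod vq cg) expr0.
  by rewrite fK // inverting //; apply: inverting_expo.
have [v [vq T2 final]] := sol_g g0 Ig0 Jg0.
have nzden: (v ^+ c g0 * v != 0)%R by rewrite mulf_neq0 ?expf_neq0 ?root_neq0.
move/eqP: T2; rewrite sqrf_eq1 => /orP[]/eqP T1.
  by apply: (final 1%R); rewrite ?expr1n // mulr1; apply: (divIf nzden); rewrite T1 divff.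
set a := c g0 in T1 nzden final.
have a1_gt0 : 0 < a + 1 by rewrite addn1.
(* Otherwise -a is 1 modulo 2^s, hence a power c0^i, and x0^i g0^-1 inverts K. *)
have lt_rs : logn 2 (a + 1) < s.
  rewrite ltnNge -pfactor_dvdn //; apply/negP=> dv.
  have [|i Di] := exists_minus1_power cyc (a := a); first by rewrite mod0n; apply/eqP; rewrite Dp.
  have Ixi := groupX i Ix0.
  have /negP[] := negbT (no_inv (x0 ^+ i * g0^-1)%g); rewrite inE groupM ?groupV //=.
  rewrite -modnDml expoM ?groupV // -modnMml expoX // -modnXm -Dc0 modnXm modnMml modnDml.
  by rewrite -modnDmr -(expoV Ig0) modnDmr -mulnDl -modnMml Di modnMml mul0n.
have [[le_sn dv_s] _ _ _ _] := cyc.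
have [m odd_m Da1] := pfactor_coprime (isT : prime 2) a1_gt0.
move: (logn 2 (a + 1)) lt_rs Da1 => r lt_rs Da1.
have le_rn : r <= n.-1 by rewrite -ltnS prednK // (leq_trans lt_rs).
(* A root of unity of order 2^(r+1). As a + 1 is 2^r times an odd number, w^(a + 1) = -1; as r < s,
   the order divides c0 - 1, so that w is invariant. *)
pose w := (zeta ^+ (2 ^ (n.-1 - r)))%R.
have w1: (w ^+ (a + 1) = -1)%R.
  have e: (2 ^ (n.-1 - r) * (a + 1) = 2 ^ n.-1 * m)%N.
    by rewrite Da1 mulnCA -expnD (subnK le_rn) mulnC.
  rewrite -exprM e exprM.
  have: ((zeta ^+ (2 ^ n.-1)) ^+ 2 == 1)%R.
    have := prim_expr_order prim_zeta; rewrite Dp => z1.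
    rewrite -exprM -expnSr prednK //; exact/eqP.
  rewrite sqrf_eq1 -[X in _ == X](expr0 zeta) (eq_prim_root_expr prim_zeta) mod0n Dp.
  rewrite modn_small ?ltn_exp2l ?prednK // expn_eq0 /= => /eqP->.
  by rewrite -signr_odd -coprime2n odd_m.
apply: (final w).
- by rewrite exprAC (prim_expr_order prim_zeta) expr1n.
- rewrite -exprM; apply/eqP; rewrite (eq_prim_root_expr prim_zeta).
  rewrite eqn_mod_dvd ?leq_pmulr // -{2}[(2 ^ _)%N]muln1 -mulnBr subn1.
  move: dv_s; rewrite Dp => dv_s; apply: dvdn_trans (dvdn_mul (dvdnn _) dv_s).
  have Dn: n = (n.-1 - r + r.+1)%N by rewrite addnS subnK // prednK.
  by rewrite -expnD dvdn_exp2l // {1}Dn leq_add2l.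
have wa: (w ^+ a * w = -1)%R by rewrite -exprSr -addn1.
rewrite exprMn mulrACA wa.
by rewrite mulrN1 -[LHS](divfK nzden) T1 mulN1r.
Qed.

Lemma crossed_extend : exists2 f, crossed I f & {in K, f =1 kappa}.
Proof.
have [// | [Dp n_gt1 [J [sKJ sJI DJ] [g Ig Jg]]]] := crossed_dichotomy.
exact: crossed_p2 DJ Ig Jg.
Qed.

End CrossedHomomorphisms.

(** * Eigenspaces of an abelian group *)

Section Projectors.
Local Open Scope ring_scope.

(** In a rank factorization P = C R, idempotency forces R C = 1. *)
Lemma mxtrace_idem (M : fieldType) m (P : 'M[M]_m) : P *m P = P -> \tr P = (\rank P)%:R.
Proof.
move=> PP; suff e: row_base P *m col_base P = 1%:M.
  by rewrite -{1}(mulmx_base P) mxtrace_mulC e mxtrace1.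
have fr := row_base_free P; have fc := col_base_full P.
apply: (row_free_inj fr); apply: (row_full_inj fc).
by rewrite mul1mx -mulmxA mulmx_base mulmxA mulmx_base PP.
Qed.

Variables (gT : finGroupType) (M : fieldType) (K : {group gT}) (m : nat).
Variable rK : mx_representation M K m.
Hypothesis char0 : [pchar M] =i pred0.

Lemma char0_neq0 k : (0 < k)%N -> k%:R != 0 :> M.
Proof. by move=> k_gt0; rewrite (proj1 (pcharf0P M) char0) -lt0n. Qed.

Lemma card_neq0 : #|K|%:R != 0 :> M.
Proof. exact: char0_neq0. Qed.

Definition proj (lam : gT -> M) : 'M[M]_m :=
  #|K|%:R^-1 *: \sum_(h in K) lam h^-1%g *: rK h.

Definition eigen k (lam : gT -> M) (U : 'M[M]_(k, m)) :=
  forall h, h \in K -> U *m rK h = lam h *: U.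

Lemma eq_proj lam mu : {in K, lam =1 mu} -> proj lam = proj mu.
Proof.
by move=> e; congr (_ *: _); apply: eq_bigr => h Kh; rewrite e ?groupV.
Qed.

Lemma eigen_projr lam : group_char K lam -> eigen lam (proj lam).
Proof.
move=> lamP h Kh; have [_ lamM] := lamP.
rewrite -scalemxAl scalerA mulrC -scalerA; congr (_ *: _).
rewrite mulmx_suml scaler_sumr (reindex_inj (mulIg h^-1%g)) /=.
apply: eq_big => [x | x]; first by rewrite groupMr ?groupV.
rewrite groupMr ?groupV // => Kx; rewrite -scalemxAl -repr_mxM ?groupM ?groupV //.
by rewrite mulgKV invMg invgK lamM ?groupV // scalerA.
Qed.

Lemma eigen_projl lam h : group_char K lam -> h \in K -> rK h *m proj lam = lam h *: proj lam.
Proof.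
move=> lamP Kh; have [_ lamM] := lamP.
rewrite -scalemxAr scalerA mulrC -scalerA; congr (_ *: _).
rewrite mulmx_sumr scaler_sumr (reindex_inj (mulgI h^-1%g)) /=.
apply: eq_big => [x | x]; first by rewrite groupMl ?groupV.
rewrite groupMl ?groupV // => Kx; rewrite -scalemxAr -repr_mxM ?groupM ?groupV //.
by rewrite mulKVg invMg invgK lamM ?groupV // scalerA mulrC.
Qed.

Lemma group_char_neq0 (lam : gT -> M) h : group_char K lam -> h \in K -> lam h != 0.
Proof.
move=> [lam1 lamM] Kh; apply: contra_eq_neq lam1 => e.
by rewrite -(mulgV h) lamM ?groupV // e mul0r eq_sym oner_neq0.
Qed.

Lemma eigen_proj k lam (U : 'M[M]_(k, m)) : group_char K lam -> eigen lam U -> U *m proj lam = U.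
Proof.
move=> lamP eigU; rewrite -scalemxAr mulmx_sumr.
rewrite (eq_bigr (fun _ => U)) => [|h Kh]; last first.
  by rewrite -scalemxAr eigU // scalerA (group_charV lamP) // mulVf ?scale1r ?group_char_neq0.
by rewrite sumr_const -scaler_nat scalerA mulVf ?scale1r ?card_neq0.
Qed.

Lemma eigen_sub k lam (U : 'M[M]_(k, m)) : group_char K lam -> eigen lam U <-> (U <= proj lam)%MS.
Proof.
move=> lamP; split=> [/(eigen_proj lamP)<- | /submxP[D ->] h Kh]; first exact: submxMl.
by rewrite -mulmxA eigen_projr // scalemxAr.
Qed.

Lemma proj_idem lam : group_char K lam -> proj lam *m proj lam = proj lam.
Proof. by move=> lamP; apply: eigen_proj => //; apply: eigen_projr. Qed.

Lemma proj_orthogonal (lam mu : gT -> M) h : group_char K lam -> group_char K mu -> h \in K ->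
  lam h != mu h -> proj lam *m proj mu = 0.
Proof.
move=> lamP muP Kh neq; have nz: lam h - mu h != 0 by rewrite subr_eq0.
apply: (scalerI nz); rewrite scaler0 scalerBl [in X in X - _]scalemxAl.
by rewrite -(eigen_projr lamP Kh) -mulmxA (eigen_projl muP Kh) -scalemxAr subrr.
Qed.

Lemma mxtrace_proj lam : group_char K lam -> \tr (proj lam) = (\rank (proj lam))%:R.
Proof. by move=> lamP; apply: mxtrace_idem; apply: proj_idem. Qed.

(** One element at a time: the Fourier components w i of v under the powers of h sum to q v, so that
    one is nonzero. It is an eigenvector of h with eigenvalue zeta^i and, K being abelian, remains
    one for the previous elements. *)
Lemma eigenvector_seq q (zeta : M) (s : seq gT) : (0 < m)%N -> abelian K -> exponent K = q ->
    q.-primitive_root zeta -> {subset s <= K} ->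
  exists2 v : 'rV[M]_m, v != 0 & forall h, h \in s -> exists c, v *m rK h = c *: v.
Proof.
move=> m_gt0 abK expK prim; elim: s => [_|h s IHs sK].
  exists (delta_mx 0 (Ordinal m_gt0)) => //.
  by apply/eqP=> /matrixP/(_ 0 (Ordinal m_gt0))/eqP; rewrite !mxE !eqxx oner_eq0.
have [|v nzv eigv] := IHs; first by move=> x sx; apply: sK; rewrite inE sx orbT.
have Kh : h \in K by apply: sK; rewrite inE eqxx.
have q_gt0 := prim_order_gt0 prim.
have nz_zeta: zeta != 0.
  by apply: contra_eq_neq (prim_expr_order prim) => ->; rewrite expr0n gtn_eqF // eq_sym oner_neq0.
pose w i := \sum_(k < q) (zeta ^- (i * k)) *: (v *m rK (h ^+ k)%g).
have sum_w: \sum_(i < q) w i = q%:R *: v.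
  rewrite exchange_big /= (bigD1 (Ordinal q_gt0)) //= [X in _ + X]big1 ?addr0.
    under eq_bigr do rewrite muln0 expr0 invr1 scale1r expg0 repr_mx1 mulmx1.
    by rewrite sumr_const card_ord scaler_nat.
  move=> k nz_k; rewrite -scaler_suml; set S := \sum_(i < q) _.
  suff -> : S = 0 by rewrite scale0r.
  have nz: zeta ^- k - 1 != 0.
    rewrite subr_eq0 invr_eq1 -(prim_order_dvd prim) gtnNdvd //.
    by rewrite lt0n; apply: contra nz_k => /eqP k0; apply/eqP/val_inj.
  apply: (mulfI nz); transitivity ((zeta ^- k) ^+ q - 1); last first.
    by rewrite mulr0 exprVn exprAC (prim_expr_order prim) expr1n invr1 subrr.
  rewrite subrX1; congr (_ * _); apply: eq_bigr => i _.
  by rewrite -exprVn mulnC exprM exprVn.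
have [i nz_wi]: exists i : 'I_q, w i != 0.
  apply/existsP; apply: contraR nzv => /existsPn w0.
  have: q%:R *: v == 0 by rewrite -sum_w big1 // => i _; apply/eqP/negPn.
  by rewrite scaler_eq0 (negPf (char0_neq0 q_gt0)).
exists (w i) => // x; rewrite inE => /predU1P[-> | sx]; last first.
  have Kx: x \in K by apply: sK; rewrite inE sx orbT.
  have [c cP] := eigv x sx; exists c.
  rewrite /w mulmx_suml scaler_sumr; apply: eq_bigr => k _.
  rewrite -scalemxAl -mulmxA -repr_mxM ?groupX // (centsP abK) ?groupX //.
  by rewrite repr_mxM ?groupX // mulmxA cP -scalemxAl !scalerA mulrC.
exists (zeta ^+ i); rewrite /w mulmx_suml scaler_sumr.
pose G k := zeta ^+ i *: (zeta ^- (i * k) *: (v *m rK (h ^+ k)%g)).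
have stepG k : zeta ^- (i * k) *: (v *m rK (h ^+ k)%g) *m rK h = G k.+1.
  rewrite /G -scalemxAl -mulmxA -repr_mxM ?groupX // -expgSr scalerA mulnS exprD.
  by rewrite invfM mulVKf // expf_neq0.
have Gq : G q = G 0%N.
  have hq: (h ^+ q = 1)%g by rewrite -expK expg_exponent.
  rewrite /G muln0 hq expg0 mulnC exprM (prim_expr_order prim).
  by rewrite expr1n.
transitivity (\sum_(k < q) G k.+1); first by apply: eq_bigr => k _; apply: stepG.
transitivity (\sum_(k < q) G k); last by apply: eq_bigr.
case: (q) q_gt0 Gq => // q' _ Gq; rewrite big_ord_recr [RHS]big_ord_recl /=.
by rewrite Gq addrC.
Qed.

Lemma eigenvector_exists q (zeta : M) : (0 < m)%N -> abelian K -> exponent K = q ->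
    q.-primitive_root zeta ->
  exists lam (v : 'rV[M]_m), [/\ v != 0, group_char K lam & eigen lam v].
Proof.
move=> m_gt0 abK expK prim.
have [|v nzv eigv] := eigenvector_seq m_gt0 abK expK prim (s := enum K).
  by move=> x; rewrite mem_enum.
have [i nzi]: exists i, v 0 i != 0.
  apply/existsP; apply: contraR nzv => /existsPn v0.
  by apply/eqP/rowP=> i; rewrite mxE; apply/eqP/negPn.
pose lam h := (v *m rK h) 0 i / v 0 i.
have lamE h : h \in K -> v *m rK h = lam h *: v.
  move=> Kh; have [|c cP] := eigv h; first by rewrite mem_enum.
  by rewrite /lam cP mxE mulfK.
exists lam, v; split=> //; split=> [|x y Kx Ky]; first by rewrite /lam repr_mx1 mulmx1 divff.
apply: (mulIf nzi); have:= lamE _ (groupM Kx Ky).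
rewrite repr_mxM // mulmxA lamE // -scalemxAl lamE // scalerA => /rowP/(_ i).
by rewrite !mxE.
Qed.

End Projectors.

(** * Galois action and inertia *)

(* [A] acts on [M] with fixed field [F], and its elements are told apart by their
   action on [zeta]: this covers the Galois group of a cyclotomic extension, any of its
   subgroups, and the trivial group acting on an algebraically closed field. *)
Record galois_datum (F M : fieldType) (j : {rmorphism F -> M}) (aT : finGroupType)
    (A : {group aT}) (sg : aT -> {rmorphism M -> M}) (e : aT -> nat) (q : nat)
    (zeta : M) : Prop := GaloisDatum {
  gd_char0 : [pchar M]%R =i pred0;
  gd_prim : (q.-primitive_root zeta)%R;
  gd_zeta : {in A, forall a, sg a zeta = zeta ^+ e a}%R;
  gd_mul : {in A &, forall a b x, sg (a * b)%g x = sg b (sg a x)};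
  gd_inj : {in A &, forall a b, e a = e b %[mod q] -> a = b};
  gd_fix : forall x, (forall a, a \in A -> sg a x = x) <-> exists y, x = j y
}.

Section Datum.
Local Open Scope ring_scope.

Variables (F M : fieldType) (j : {rmorphism F -> M}) (aT : finGroupType).
Variables (A : {group aT}) (sg : aT -> {rmorphism M -> M}) (e : aT -> nat).
Variables (q : nat) (zeta : M).
Hypothesis D : galois_datum j A sg e q zeta.

Let prim := gd_prim D.
Let q_gt0 := prim_order_gt0 prim.

Lemma gd1 x : sg 1%g x = x.
Proof. by apply: (fmorph_inj (sg 1%g)); rewrite -(gd_mul D) ?group1 // mulg1. Qed.

Lemma map_gd1 k m (X : 'M[M]_(k, m)) : map_mx (sg 1%g) X = X.
Proof. by apply/matrixP=> u v; rewrite mxE gd1. Qed.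

Lemma gdVK a x : a \in A -> sg a^-1%g (sg a x) = x.
Proof. by move=> Aa; rewrite -(gd_mul D) ?groupV // mulgV gd1. Qed.

Lemma gd_root a u : a \in A -> u ^+ q = 1 -> sg a u = u ^+ e a.
Proof.
by move=> Aa /(prim_rootP prim)[i ->]; rewrite rmorphXn (gd_zeta D) // -!exprM mulnC.
Qed.

Lemma gd_expM a b : a \in A -> b \in A -> e (a * b)%g = e a * e b %[mod q].
Proof.
move=> Aa Ab; apply/eqP; rewrite -(eq_prim_root_expr prim) -(gd_zeta D) ?groupM //.
by rewrite (gd_mul D) // (gd_zeta D Aa) rmorphXn (gd_zeta D Ab) -exprM mulnC.
Qed.

Lemma gd_exp1 : e 1%g = 1%N %[mod q].
Proof.
by apply/eqP; rewrite -(eq_prim_root_expr prim) -(gd_zeta D) // gd1 expr1.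
Qed.

Lemma gd_rational k m (X : 'M[M]_(k, m)) :
  {in A, forall a, map_mx (sg a) X = X} -> exists X0 : 'M[F]_(k, m), X = map_mx j X0.
Proof.
move=> fixX; have ex i i' : exists y, X i i' = j y.
  by apply/(gd_fix D) => a /fixX/matrixP/(_ i i'); rewrite mxE.
have rowex i : exists f : 'I_m -> F, forall i', X i i' = j (f i').
  by have [f fP] := fin_all_exists (ex i); exists f.
have [f fP] := fin_all_exists rowex.
by exists (\matrix_(i, i') f i i'); apply/matrixP=> i i'; rewrite !mxE.
Qed.

(* Dedekind independence of the powers of [zeta ^+ e a], by Lagrange interpolation. *)
Lemma gd_independent k m (V : aT -> 'M[M]_(k, m)) : V 1%g != 0 ->
  exists i : nat, \sum_(a in A) zeta ^+ (i * e a) *: V a != 0.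
Proof.
move=> nzV; suff /existsP[i nzi] : [exists i : 'I_q, \sum_(a in A) zeta ^+ (i * e a) *: V a != 0].
  by exists i.
apply: contraR nzV => /existsPn V0.
have{}V0 i : \sum_(a in A) zeta ^+ (i * e a) *: V a = 0.
  have /negPn/eqP V0i := V0 (Ordinal (ltn_pmod i q_gt0)).
  rewrite -[RHS]V0i; apply: eq_bigr => a _ /=.
  by rewrite !exprM (prim_expr_mod prim).
have polyV (P : {poly M}) : \sum_(a in A) P.[zeta ^+ e a] *: V a = 0.
  under eq_bigr do rewrite horner_coef scaler_suml.
  rewrite exchange_big big1 //= => i _; rewrite -[RHS](scaler0 _ P`_i) -[in RHS](V0 i) scaler_sumr.
  apply: eq_bigr => a _.
  by rewrite scalerA -exprM mulnC.
pose P := \prod_(a in A | a != 1%g) ('X - (zeta ^+ e a)%:P).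
have := polyV P; rewrite (bigD1 1%g) //= big1 ?addr0 => [|a /andP[Aa na1]]; last first.
  by rewrite horner_prod (bigD1 a) ?Aa //= hornerXsubC subrr mul0r scale0r.
move/eqP; rewrite scaler_eq0 => /orP[] // /eqP P1.
suff: P.[zeta ^+ e 1%g] != 0 by rewrite P1 eqxx.
rewrite horner_prod prodf_seq_neq0; apply/allP=> a _; apply/implyP=> /andP[Aa na1].
rewrite hornerXsubC subr_eq0 (eq_prim_root_expr prim); apply: contra na1 => /eqP.
by move/(gd_inj D (group1 A) Aa) <-.
Qed.

(** The sum is the trace of zeta^i X; traces are rational, and by independence one of these is
    nonzero. *)
Lemma gd_trace k m (X : 'M[M]_(k, m)) : X != 0 ->
  exists (X0 : 'M[F]_(k, m)) i, X0 != 0 /\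
    map_mx j X0 = \sum_(a in A) zeta ^+ (i * e a) *: map_mx (sg a) X.
Proof.
move=> nzX; have [|i nzS] := @gd_independent _ _ (fun a => map_mx (sg a) X).
  by rewrite map_gd1.
have [|X0 DX0] := @gd_rational _ _ (\sum_(a in A) zeta ^+ (i * e a) *: map_mx (sg a) X).
  move=> b Ab; rewrite raddf_sum /= [RHS](reindex_inj (mulIg b)) /=.
  apply: eq_big => [a | a Aa]; first by rewrite groupMr.
  apply/matrixP=> u v; rewrite !mxE rmorphM (gd_mul D) //; congr (_ * _).
  have za: (zeta ^+ (i * e a)) ^+ q = 1 by rewrite exprAC (prim_expr_order prim) expr1n.
  rewrite (gd_root Ab za) -exprM -mulnA; apply/eqP.
  by rewrite (eq_prim_root_expr prim) -modnMmr -gd_expM // modnMmr.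
exists X0, i; split=> //; move: nzS; rewrite DX0; apply: contraNneq => ->.
by rewrite map_mx0.
Qed.

End Datum.

Section Inertia.
Local Open Scope ring_scope.

Variables (F M : fieldType) (j : {rmorphism F -> M}) (aT : finGroupType).
Variables (A : {group aT}) (sg : aT -> {rmorphism M -> M}) (e : aT -> nat).
Variables (p n : nat) (zeta : M).
Hypothesis pr_p : prime p.
Local Notation q := (p ^ n)%N.
Hypothesis D : galois_datum j A sg e q zeta.
Let prim := gd_prim D.
Let char0 := gd_char0 D.

Variables (gT : finGroupType) (G H K : {group gT}).
Hypotheses (sKH : K \subset H) (sHG : H \subset G) (abK : abelian K).
Hypotheses (derG : [~: G, G]%g \subset K) (selfC : 'C_G(K)%g \subset K).
Hypothesis expK : exponent K = q.

Let sKG : K \subset G. Proof. exact: subset_trans sHG. Qed.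
Let nKG : G \subset 'N(K)%g.
Proof. by rewrite -commg_subr (subset_trans _ derG) // commgSS. Qed.
Let nKH : H \subset 'N(K)%g. Proof. exact: subset_trans nKG. Qed.
Let expKh h : h \in K -> (h ^+ q = 1)%g.
Proof. by move=> Kh; rewrite -expK expg_exponent. Qed.

(* With [H = G], the set [pinertia_set] is the inertia group of every character of K
   with core-free kernel, and [frob] sends x to the element of [A] with the same power map. *)
Definition powers x a := [forall h in K, (h ^ x == h ^+ e a)%g].

Lemma powersP x a : reflect {in K, forall h, h ^ x = h ^+ e a}%g (powers x a).
Proof. exact: eqfun_inP. Qed.

Definition pinertia_set := [set x in H | [exists a in A, powers x a]].

Definition frob x : aT := odflt 1%g [pick a in A | powers x a].

Lemma frobP x : x \in pinertia_set ->
  [/\ x \in H, frob x \in A & {in K, forall h, h ^ x = h ^+ e (frob x)}%g].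
Proof.
rewrite inE => /andP[Hx /existsP[a /andP[Aa xa]]]; rewrite /frob.
case: pickP => [b /andP[Ab /powersP xb] | /(_ a)]; first by split.
by rewrite Aa xa.
Qed.

Lemma eq_expK i i' : {in K, forall h, h ^+ i = h ^+ i'}%g <-> i = i' %[mod q].
Proof. exact: (eq_exponent abK expK). Qed.

Lemma frob_eq x a : x \in H -> a \in A -> {in K, forall h, h ^ x = h ^+ e a}%g ->
  x \in pinertia_set /\ frob x = a.
Proof.
move=> Hx Aa xa; have Ix: x \in pinertia_set.
  by rewrite inE Hx; apply/existsP; exists a; rewrite Aa; apply/powersP.
split=> //; have [_ Ab xb] := frobP Ix; apply: (gd_inj D) => //.
by apply/eq_expK => h Kh; rewrite -xb ?xa.
Qed.

Lemma frob_K x : x \in K -> x \in pinertia_set /\ frob x = 1%g.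
Proof.
move=> Kx; apply: frob_eq; rewrite ?group1 ?(subsetP sKH) // => h Kh.
rewrite (proj2 (eq_expK _ 1)) ?(gd_exp1 D) // expg1.
by apply/conjg_fixP/commgP/(centsP abK).
Qed.

Lemma frob_M x y : x \in pinertia_set -> y \in pinertia_set ->
  (x * y)%g \in pinertia_set /\ frob (x * y)%g = (frob x * frob y)%g.
Proof.
case/frobP=> Hx Ax xP /frobP[Hy Ay yP]; apply: frob_eq; rewrite ?groupM // => h Kh.
rewrite conjgM xP // yP ?groupX // -expgM.
by apply/(proj2 (eq_expK _ _)); rewrite // -(gd_expM D) // (gd_expM D) // mulnC.
Qed.

Lemma pinertia_group_set : group_set pinertia_set.
Proof.
apply/group_setP; split=> [|x y Ix Iy]; first by case: (frob_K (group1 K)).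
by case: (frob_M Ix Iy).
Qed.
Canonical pinertia := Group pinertia_group_set.
Local Notation I := pinertia.

Lemma sub_pinertia : K \subset I.
Proof. by apply/subsetP=> x /frob_K[]. Qed.

Lemma pinertia_sub : I \subset H.
Proof. by apply/subsetP=> x /frobP[]. Qed.

Lemma frob_in x : x \in I -> frob x \in A.
Proof. by case/frobP. Qed.

Lemma frobJ x h : x \in I -> h \in K -> (h ^ x = h ^+ e (frob x))%g.
Proof. by case/frobP => _ _; apply. Qed.

Lemma frobM x y : x \in I -> y \in I -> frob (x * y)%g = (frob x * frob y)%g.
Proof. by move=> Ix Iy; case: (frob_M Ix Iy). Qed.

Lemma frob1 x : x \in I -> (frob x == 1%g) = (x \in K).
Proof.
move=> Ix; apply/eqP/idP=> [fx1 | /frob_K[] //].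
have Hx := subsetP pinertia_sub x Ix.
apply: (subsetP selfC); rewrite inE (subsetP sHG) //; apply/centP=> h Kh.
apply/commute_sym/commgP/conjg_fixP; rewrite (frobJ Ix Kh) fx1.
by rewrite (proj2 (eq_expK _ 1)) ?(gd_exp1 D) // expg1.
Qed.

Lemma derI : [~: I, I]%g \subset K.
Proof. by rewrite (subset_trans _ derG) // commgSS // (subset_trans pinertia_sub). Qed.

Lemma selfCI : 'C_I(K)%g \subset K.
Proof. by rewrite (subset_trans _ selfC) // setSI // (subset_trans pinertia_sub). Qed.

Definition corefree (lam : gT -> M) :=
  forall k, k \in K -> (forall x, x \in G -> lam (k ^ x)%g = 1) -> k = 1%g.

Lemma conjgK_comm h x y : h \in K -> x \in G -> y \in G -> ((h ^ x) ^ y = (h ^ y) ^ x)%g.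
Proof.
move=> Kh Gx Gy; rewrite -!conjgM commgC conjgM.
have Kc : [~ x, y] \in K by apply: (subsetP derG); apply: mem_commg.
have Kh' : (h ^ (y * x))%g \in K by rewrite memJ_norm // (subsetP nKG) ?groupM.
by apply/conjg_fixP/commgP/(centsP abK).
Qed.

(* Since G/K is abelian, the identity lam (h ^ x) = lam (h ^+ c) is inherited by all
   the conjugates of lam, whose kernels intersect trivially. *)
Lemma corefree_power lam x c : group_char K lam -> corefree lam -> x \in G ->
  {in K, forall h, lam (h ^ x)%g = lam h ^+ c} -> {in K, forall h, h ^ x = h ^+ c}%g.
Proof.
move=> lamP cf Gx e_lam h Kh; have [lam1 lamM] := lamP.
have KJ k y : k \in K -> y \in G -> (k ^ y)%g \in K.
  by move=> Kk Gy; rewrite memJ_norm // (subsetP nKG).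
suff: (h ^ x * h ^- c)%g = 1%g by move/eqP; rewrite -eq_mulgV1 => /eqP.
apply: cf => [|y Gy]; first by rewrite groupM ?groupV ?groupX ?KJ.
rewrite conjMg conjVg conjXg lamM ?groupV ?groupX ?KJ // (group_charV lamP) ?groupX ?KJ //.
rewrite (group_charX _ lamP) ?KJ // conjgK_comm // e_lam ?KJ // divff //.
by rewrite expf_neq0 // (group_char_neq0 lamP) ?KJ.
Qed.

Definition conj_char (lam : gT -> M) x a h := sg a (lam (h ^ x^-1)%g).

Lemma memKJ h x : h \in K -> x \in G -> (h ^ x)%g \in K.
Proof. by move=> Kh Gx; rewrite memJ_norm // (subsetP nKG). Qed.

Lemma conj_charP lam x a : group_char K lam -> x \in G -> group_char K (conj_char lam x a).
Proof.
case=> lam1 lamM Gx; split=> [|h k Kh Kk]; rewrite /conj_char.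
  by rewrite conj1g lam1 rmorph1.
by rewrite conjMg lamM ?memKJ ?groupV // rmorphM.
Qed.

Lemma char_root (lam : gT -> M) h : group_char K lam -> h \in K -> lam h ^+ q = 1.
Proof. by move=> lamP Kh; rewrite -(group_charX _ lamP) // expKh //; case: lamP. Qed.

Lemma conj_charE lam x a h : group_char K lam -> x \in G -> a \in A -> h \in K ->
  conj_char lam x a h = lam (h ^ x^-1)%g ^+ e a.
Proof.
by move=> lamP Gx Aa Kh; rewrite /conj_char (gd_root D Aa) // char_root ?memKJ ?groupV.
Qed.

Lemma conj_char_frob lam x h : group_char K lam -> x \in I -> h \in K ->
  conj_char lam x (frob x) h = lam h.
Proof.
move=> lamP Ix Kh; have Gx: x \in G by rewrite (subsetP sHG) ?(subsetP pinertia_sub).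
rewrite conj_charE ?frob_in // -(group_charX _ lamP) ?memKJ ?groupV //.
by rewrite -frobJ ?memKJ ?groupV // conjgKV.
Qed.

(** The stabilizer of lam in H x A is the graph of [frob]: if the two conjugates agree, then x y^-1
    acts on K as the power e (a b^-1). *)
Lemma conj_char_inj lam x y a b : group_char K lam -> corefree lam ->
    x \in H -> y \in H -> a \in A -> b \in A ->
    {in K, conj_char lam x a =1 conj_char lam y b} ->
  (I :* x = I :* y)%g /\ (x = y -> a = b).
Proof.
move=> lamP cf Hx Hy Aa Ab e_xy.
have [Gx Gy] := (subsetP sHG x Hx, subsetP sHG y Hy).
have key: {in K, forall h, h ^ (x * y^-1) = h ^+ e (a * b^-1)}%g.
  apply: (corefree_power lamP cf) => [|h Kh]; first by rewrite groupM ?groupV.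
  rewrite -(gd_root D) ?groupM ?groupV ?char_root //.
  have := e_xy _ (memKJ Kh Gx); rewrite /conj_char conjgK => /(congr1 (sg b^-1%g)).
  by rewrite (gdVK D) // -(gd_mul D) ?groupV // conjgM => ->.
have [Iz fz] := frob_eq (groupM Hx (groupVr Hy)) (groupM Aa (groupVr Ab)) key.
split; first by apply/rcoset_eqP; rewrite mem_rcoset.
move=> Dx; apply/eqP; rewrite eq_mulgV1 -fz Dx mulgV.
by case: (frob_K (group1 K)) => _ ->.
Qed.

(** The values are arbitrary nonzero scalars and not only roots of unity, because this is what the
    action on an eigenline provides. *)
Definition cocycle (J : {set gT}) (lam f : gT -> M) :=
  [/\ forall x, x \in J -> f x != 0,
      forall x y, x \in J -> y \in J -> f (x * y)%g = sg (frob y) (f x) * f y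
    & {in K, f =1 lam}].

Definition has_cocycle lam := exists f, cocycle I lam f.

Lemma crossed_cocycle (J : {group gT}) lam f : J \subset I ->
  crossed p n (fun x => e (frob x)) J f -> {in K, f =1 lam} -> cocycle J lam f.
Proof.
move=> sJI [fq fM] f_lam; split=> // [x Jx | x y Jx Jy].
  by rewrite (root_neq0 pr_p (fq x Jx)).
by rewrite fM // (gd_root D) ?fq // frob_in // (subsetP sJI).
Qed.

Lemma cocycle_index2 lam : group_char K lam ->
  exists (J : {group gT}) (f : gT -> M),
    [/\ K \subset J, J \subset I, cocycle J lam f
      & forall x y, x \in I -> x \notin J -> y \in I -> y \notin J -> (x * y)%g \in J].
Proof.
move=> lamP; have cP x h: x \in I -> h \in K -> (h ^ x = h ^+ e (frob x))%g by apply: frobJ.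
have [J [f [sKJ sJI fP f_lam i2]]] :=
  crossed_index2 pr_p prim sub_pinertia abK derI expK selfCI cP lamP.
by exists J, f; split=> //; apply: crossed_cocycle.
Qed.

(* If g inverts K then g ^+ 2 is central of order at most 2 in G, and both lam and
   lam' detect whether it is trivial. *)
Lemma cocycle_transfer lam lam' : group_char K lam -> corefree lam ->
  group_char K lam' -> corefree lam' -> has_cocycle lam -> has_cocycle lam'.
Proof.
move=> lamP cf lamP' cf' [f [f0 fM f_lam]].
pose kap h := lam' h / lam h.
have kapP : group_char K kap.
  split=> [|x y Kx Ky]; rewrite /kap; first by rewrite lamP.1 lamP'.1 divr1.
  by rewrite lamP.2 // lamP'.2 // mulf_div.
have cP x h: x \in I -> h \in K -> (h ^ x = h ^+ e (frob x))%g by apply: frobJ.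
have [|f1 f1P f1_kap] :=
    crossed_extend pr_p prim sub_pinertia abK derI expK selfCI cP kapP.
  move=> g Ig gK; have Gg: g \in G by rewrite (subsetP sHG) ?(subsetP pinertia_sub).
  set z := (g * g)%g; have Kz: z \in K.
    apply: (subsetP selfC); rewrite inE groupM //; apply/centP=> h Kh.
    by apply/commute_sym/commgP/conjg_fixP; rewrite conjgM !gK ?groupV // invgK.
  have zG x : x \in G -> (z ^ x = z)%g.
    move=> Gx; have Kc : [~ g, x] \in K by apply: (subsetP derG); apply: mem_commg.
    rewrite /z conjMg (conjg_mulR g x); move: [~ g, x] Kc => k Kk.
    have ->: (g * k * (g * k) = g * g * k ^ g * k)%g.
      by rewrite conjgE !mulgA mulgK.
    by rewrite gK // mulgKV.
  have zz : (z * z = 1)%g by rewrite -{2}(zG g Gg) gK // mulgV.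
  have detect mu : group_char K mu -> corefree mu -> mu z = if z == 1%g then 1 else -1.
    move=> muP mucf; case: eqP => [-> | nz1]; first by case: muP.
    have: mu z ^+ 2 == 1 by rewrite -(group_charX 2 muP) // expgS expg1 zz; case: muP => ->.
    rewrite sqrf_eq1 => /orP[/eqP muz1 | /eqP //]; case: nz1.
    by apply: mucf => // x Gx; rewrite zG.
  by rewrite /kap !detect // divff //; case: ifP => _; rewrite ?oppr_eq0 oner_neq0.
have [g0 gM g_kap] := crossed_cocycle (subxx I) f1P f1_kap.
exists (fun x => f x * f1 x); split=> [x Ix | x y Ix Iy | h Kh /=].
- by rewrite mulf_neq0 ?f0 ?g0.
- by rewrite fM // gM // rmorphM mulrACA.
by rewrite f_lam // g_kap // /kap mulrC divfK // (group_char_neq0 lamP).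
Qed.

(** * The semilinear action on an irreducible representation *)

Section Representation.

Variables (m : nat) (rH : mx_representation F H m).
Let rM := map_repr j rH.
Let rK := subg_repr rM sKH.
Local Notation proj := (proj rK).
Local Notation eigen := (eigen rK).

(** Right semilinear action of H x A on row vectors; on the characters of K it induces
    [conj_char]. *)
Definition twist k x a (U : 'M[M]_(k, m)) := map_mx (sg a) U *m rM x.

Lemma map_rM a x : a \in A -> map_mx (sg a) (rM x) = rM x.
Proof.
move=> Aa; apply/matrixP=> u v; rewrite !mxE; apply/(gd_fix D _).2 => //.
by exists (rH x u v).
Qed.

Lemma eigen_twist k lam x a (U : 'M_(k, m)) : eigen lam U -> x \in H -> a \in A ->
  eigen (conj_char lam x a) (twist x a U).
Proof.
move=> eigU Hx Aa h Kh; have Hh := subsetP sKH h Kh.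
have Kh' : (h ^ x^-1)%g \in K by rewrite memJ_norm // (subsetP nKH) ?groupV.
rewrite /twist -mulmxA /= -/rM.
have ->: rM x *m rM h = rM (h ^ x^-1)%g *m rM x.
  by rewrite -!repr_mxM ?groupJ ?groupV // conjgE invgK mulgA mulgKV.
rewrite mulmxA -(map_rM _ Aa) -map_mxM; have /= -> := eigU _ Kh'.
by rewrite map_mxZ -scalemxAl.
Qed.

Lemma twistM k x y a b (U : 'M_(k, m)) : x \in H -> y \in H -> a \in A -> b \in A ->
  twist y b (twist x a U) = twist (x * y)%g (a * b)%g U.
Proof.
move=> Hx Hy Aa Ab; rewrite /twist map_mxM map_rM // -mulmxA -repr_mxM //.
by congr (_ *m _); apply/matrixP=> u v; rewrite !mxE (gd_mul D).
Qed.

Lemma twistS k1 k2 x a (U : 'M_(k1, m)) (V : 'M_(k2, m)) :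
  (U <= V)%MS -> (twist x a U <= twist x a V)%MS.
Proof. by move=> sUV; rewrite submxMr // map_submx. Qed.

Lemma rank_twist k x a (U : 'M_(k, m)) : x \in H -> \rank (twist x a U) = \rank U.
Proof. by move=> Hx; rewrite mxrankMfree ?mxrank_map // repr_mx_free. Qed.

(** A trace of a nonzero row of U is a nonzero F-rational vector in the span of the Galois
    conjugates of U. Its H-span is defined over F, hence is the whole space. *)
Lemma twist_full k k' (U : 'M_(k, m)) (Z : 'M_(k', m)) : mx_irreducible rH -> U != 0 ->
    (forall g a, g \in H -> a \in A -> (twist g a U <= Z)%MS) -> row_full Z.
Proof.
move=> /mx_irrP[_ irr] nzU sUZ; have nzv : nz_row U != 0 by rewrite nz_row_eq0.
have [u [i [nzu Du]]] := gd_trace D nzv.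
pose W := \matrix_(k < #|H|) (u *m rH (enum_val k)).
have Wsub g : g \in H -> (u *m rH g <= W)%MS.
  move=> Hg; apply: (eq_row_sub (enum_rank_in Hg g)).
  by rewrite rowK enum_rankK_in.
have Wmod : mxmodule rH <<W>>%MS.
  rewrite (eqmx_module _ (genmxE _)); apply/mxmoduleP => x Hx.
  apply/row_subP=> k0; rewrite row_mul rowK -mulmxA -repr_mxM ?enum_valP //.
  by apply: Wsub; rewrite groupM ?enum_valP.
have nzW : <<W>>%MS != 0.
  rewrite -mxrank_eq0 genmxE mxrank_eq0; apply: contraNneq nzu => W0.
  by have := Wsub 1%g (group1 H); rewrite repr_mx1 mulmx1 W0 => /submx0null->.
have := irr _ Wmod nzW; rewrite -sub1mx genmxE sub1mx -(row_full_map j) -!sub1mx => sW.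
apply: submx_trans sW _; apply/row_subP=> k0; rewrite -map_row rowK map_mxM Du.
rewrite mulmx_suml summx_sub // => a Aa; rewrite -scalemxAl scalemx_sub //.
have Hk := enum_valP k0; apply: submx_trans (sUZ _ a Hk Aa).
by apply: twistS; apply: nz_row_sub.
Qed.

Definition stable k (U : 'M_(k, m)) := forall x, x \in I -> (twist x (frob x) U <= U)%MS.

(** As U is stable, it suffices to twist by representatives of the cosets of the graph of [frob] in
    H x A, such as the pairs (repr C, a). *)
Lemma stable_full k k' (U : 'M_(k, m)) (Z : 'M_(k', m)) : mx_irreducible rH -> U != 0 ->
    stable U ->
    (forall C a, C \in rcosets I H -> a \in A -> (twist (repr C) a U <= Z)%MS) ->
  row_full Z.
Proof.
move=> irr nzU stU sUZ; apply: (twist_full irr nzU) => g a Hg Aa.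
have CP : (I :* g)%g \in rcosets I H by apply/rcosetsP; exists g.
have [x Ix Dr] : exists2 x, x \in I & repr (I :* g)%g = (x * g)%g.
  by case: repr_rcosetP => x Ix; exists x.
have Ix' := groupVr Ix; have Ax := frob_in Ix'; have Hx := subsetP pinertia_sub _ Ix'.
have Dg : (g = x^-1 * repr (I :* g))%g by rewrite Dr mulKg.
have Hr : repr (I :* g)%g \in H by rewrite Dr groupM // -groupV.
have Aa' : ((frob x^-1%g)^-1 * a)%g \in A by rewrite groupM ?groupV.
have -> : twist g a U =
    twist (repr (I :* g)%g) ((frob x^-1%g)^-1 * a)%g (twist x^-1%g (frob x^-1%g) U).
  by rewrite twistM // mulKVg -Dg.
by apply: submx_trans (sUZ _ _ CP Aa'); apply: twistS; apply: stU.
Qed.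

Lemma rank_stable k (U : 'M_(k, m)) : mx_irreducible rH -> U != 0 -> stable U ->
  (m <= #|H : I| * #|A| * \rank U)%N.
Proof.
move=> irr nzU stU; pose Z := (\sum_(C in rcosets I H) \sum_(a in A) <<twist (repr C) a U>>)%MS.
have /eqP rkZ : row_full Z.
  apply: (stable_full irr nzU stU) => C a IC Aa.
  by rewrite (sumsmx_sup C) // (sumsmx_sup a) // genmxE.
have HC C : C \in rcosets I H -> repr C \in H.
  case/rcosetsP=> x Hx ->; case: repr_rcosetP => y /(subsetP pinertia_sub) Hy.
  by rewrite groupM.
rewrite -[X in (X <= _)%N]rkZ; apply: leq_trans (mxrank_sum_leqif _) _ => /=.
apply: (@leq_trans (\sum_(C in rcosets I H) #|A| * \rank U)); last first.
  by rewrite sum_nat_const mulnA.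
apply: leq_sum => C IC.
rewrite -sum_nat_const; apply: leq_sum => a Aa.
by rewrite genmxE rank_twist ?HC.
Qed.

Lemma rank_proj_conj lam x a : group_char K lam -> x \in H -> a \in A ->
  \rank (proj (conj_char lam x a)) = \rank (proj lam).
Proof.
have le mu y b : group_char K mu -> y \in H -> b \in A ->
    (\rank (proj mu) <= \rank (proj (conj_char mu y b)))%N.
  move=> muP Hy Ab; rewrite -(rank_twist b (proj mu) Hy); apply: mxrankS.
  apply/eigen_sub => //; first by apply: conj_charP; rewrite ?(subsetP sHG).
  by apply: eigen_twist => //; apply: eigen_projr.
move=> lamP Hx Aa; have lamP' : group_char K (conj_char lam x a).
  by apply: conj_charP; rewrite ?(subsetP sHG).
apply/eqP; rewrite eqn_leq le // andbT.
apply: leq_trans (le _ x^-1%g a^-1%g lamP' _ _) _; rewrite ?groupV //.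
rewrite (@eq_proj _ _ _ _ rK (conj_char (conj_char lam x a) x^-1%g a^-1%g) lam) //.
by move=> h Kh; rewrite /conj_char invgK conjgK (gdVK D).
Qed.

Lemma twistZ k x a c (U : 'M_(k, m)) : twist x a (c *: U) = sg a c *: twist x a U.
Proof. by rewrite /twist map_mxZ scalemxAl. Qed.

Lemma twist_sum k x a (J : finType) (P : pred J) (U : J -> 'M_(k, m)) :
  twist x a (\sum_(i | P i) U i) = \sum_(i | P i) twist x a (U i).
Proof. by rewrite /twist raddf_sum mulmx_suml. Qed.

Lemma twist_frobM k x y (U : 'M_(k, m)) : x \in I -> y \in I ->
  twist y (frob y) (twist x (frob x) U) = twist (x * y)%g (frob (x * y)%g) U.
Proof.
move=> Ix Iy; have [[Hx Ax _] [Hy Ay _]] := (frobP Ix, frobP Iy).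
by rewrite twistM // frobM.
Qed.

Lemma eigen_frob k lam x (U : 'M_(k, m)) : group_char K lam -> x \in I ->
  eigen lam U -> eigen lam (twist x (frob x) U).
Proof.
move=> lamP Ix eigU h Kh; have [Hx Ax _] := frobP Ix.
by rewrite (eigen_twist eigU Hx Ax) // conj_char_frob.
Qed.

(* Galois descent for the semilinear action of J on the lam-eigenspace, twisted by f. *)
Lemma cocycle_line (J : {group gT}) lam f (v : 'rV_m) : group_char K lam ->
    K \subset J -> J \subset I -> cocycle J lam f -> v != 0 -> eigen lam v ->
  exists w : 'rV_m, [/\ w != 0, eigen lam w &
    forall y, y \in J -> twist y (frob y) w = f y *: w].
Proof.
move=> lamP sKJ sJI [f0 fM f_lam] nzv eigv.
(* The twisted average of v, split according to the Galois element. V 1 is |K| v since [frob] is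
   trivial exactly on K; by independence the average of some zeta^i v is then nonzero. *)
pose V a := \sum_(x in J | frob x == a) (f x)^-1 *: twist x a v.
have [|i nzS] := @gd_independent _ _ _ _ _ _ _ _ _ D _ _ V.
  suff ->: V 1%g = #|K|%:R *: v by rewrite scaler_eq0 (negPf nzv) orbF char0_neq0.
  rewrite /V (eq_bigl (mem K)) => [|x]; last first.
    apply/andP/idP=> [[Jx] | Kx]; first by rewrite frob1 // (subsetP sJI).
    by rewrite (subsetP sKJ) // frob1 // (subsetP sub_pinertia).
  rewrite (eq_bigr (fun _ => v)) => [|x Kx].
    by rewrite sumr_const scaler_nat.
  have -> : twist x 1%g v = lam x *: v.
    by rewrite -(eigv x Kx) /twist (map_gd1 D).
  by rewrite f_lam // scalerA mulVf ?scale1r // (group_char_neq0 lamP).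
set w := \sum_(a in A) _ in nzS.
have Dw : w = \sum_(x in J) (f x)^-1 *: twist x (frob x) (zeta ^+ i *: v).
  rewrite (partition_big frob (mem A)) => [|x Jx]; last exact: frob_in (subsetP sJI x Jx).
  apply: eq_bigr => a Aa; rewrite /V scaler_sumr; apply: eq_bigr => x /andP[_ /eqP->].
  rewrite twistZ rmorphXn (gd_zeta D Aa) -exprM [(e a * i)%N]mulnC.
  by rewrite !scalerA mulrC.
have eigz : eigen lam (zeta ^+ i *: v).
  by move=> h Kh; rewrite -scalemxAl eigv // !scalerA mulrC.
exists w; split=> // [h Kh | y Jy].
  rewrite Dw mulmx_suml scaler_sumr; apply: eq_bigr => x Jx.
  rewrite -scalemxAl (eigen_frob lamP _ eigz) ?(subsetP sJI) //.
  by rewrite !scalerA mulrC.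
rewrite {1}Dw twist_sum Dw scaler_sumr [RHS](reindex_inj (mulIg y)) /=.
apply: eq_big => [x | x Jx]; first by rewrite groupMr.
set u := zeta ^+ i *: v; rewrite twistZ twist_frobM ?(subsetP sJI) // fmorphV fM //.
rewrite invfM scalerA; congr (_ *: _).
by rewrite mulrCA mulfV ?mulr1 // f0.
Qed.

Lemma stable_proj lam : group_char K lam -> stable (proj lam).
Proof.
move=> lamP x Ix; apply/eigen_sub => //; apply: eigen_frob => //.
exact: eigen_projr.
Qed.

(** I acts on the eigenline by scalars, and semilinearity turns multiplicativity into the cocycle
    rule. *)
Lemma line_cocycle lam : group_char K lam -> \rank (proj lam) = 1%N -> has_cocycle lam.
Proof.
move=> lamP rk1; set w := nz_row (proj lam).
have nzw : w != 0 by rewrite nz_row_eq0 -mxrank_eq0 rk1.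
have eqw : (w :=: proj lam)%MS.
  apply/eqmxP; rewrite nz_row_sub.
  by rewrite -(geq_leqif (mxrank_leqif_sup (nz_row_sub _))) rk1 rank_rV nzw.
have eigw : eigen lam w by apply/eigen_sub; rewrite ?nz_row_sub.
have [i nzi] : exists i, w 0 i != 0.
  apply/existsP; apply: contraR nzw => /existsPn w0.
  by apply/eqP/rowP=> i; rewrite mxE; apply/eqP/negPn.
pose f x := twist x (frob x) w 0 i / w 0 i.
have fE x : x \in I -> twist x (frob x) w = f x *: w.
  move=> Ix; have: (twist x (frob x) w <= w)%MS.
    by rewrite eqw; apply/eigen_sub => //; apply: eigen_frob.
  by case/sub_rVP=> c Dc; rewrite /f Dc mxE mulfK.
exists f; split=> [x Ix | x y Ix Iy | h Kh].
- have [Hx _ _] := frobP Ix; have := rank_twist (frob x) w Hx.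
  rewrite fE //; apply: contra_eq_neq => ->; rewrite scale0r mxrank0 rank_rV nzw //.
- apply: (mulIf nzi); have := twist_frobM w Ix Iy.
  rewrite (fE x) // twistZ !fE ?groupM // scalerA => /rowP/(_ i).
  by rewrite !mxE.
have [Ih fh] := frob_K Kh; apply: (mulIf nzi); rewrite /f divfK // fh.
transitivity ((w *m rK h) 0 i); last by rewrite eigw // mxE.
by rewrite /twist (map_gd1 D).
Qed.

(** The condition on N covers both a faithful representation of H = G and a core-free kernel with H
    = K. The vectors fixed by N form a submodule over F, which is nonzero since it is so over M;
    hence N acts trivially. *)
Lemma eigen_corefree lam (v : 'rV_m) : group_char K lam -> mx_irreducible rH ->
    (forall N : {group gT}, (N <| G)%g -> N \subset K -> N \subset rker rH -> N :=: 1%g) ->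
    v != 0 -> eigen lam v -> corefree lam.
Proof.
move=> lamP irr noN nzv eigv; have [lam1 lamM] := lamP.
pose Ns := [set k in K | [forall x in G, lam (k ^ x)%g == 1]].
have NsP k : reflect (k \in K /\ forall x, x \in G -> lam (k ^ x)%g = 1) (k \in Ns).
  rewrite inE; apply: (iffP andP) => [[Kk /eqfun_inP kx] | [Kk kx]]; first by split.
  by split=> //; apply/eqfun_inP.
have Ngrp : group_set Ns.
  apply/group_setP; split=> [|x y /NsP[Kx x1] /NsP[Ky y1]]; apply/NsP; split=> [|z Gz].
  - exact: group1.
  - by rewrite conj1g.
  - exact: groupM.
  by rewrite conjMg lamM ?memKJ // x1 ?y1 ?mulr1.
pose N := Group Ngrp.
have sNK : N \subset K by apply/subsetP=> k /NsP[].
have nNG : (N <| G)%g.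
  rewrite /normal (subset_trans sNK) //=; apply/subsetP=> x Gx; rewrite inE.
  apply/subsetP=> _ /imsetP[k /NsP[Kk k1] ->]; apply/NsP; split; first exact: memKJ.
  by move=> y Gy; rewrite -conjgM k1 ?groupM.
have sNH : N \subset H by apply: subset_trans sKH.
have fixv k : k \in N -> v *m rM k = v.
  move=> /NsP[Kk k1]; have /= -> := eigv k Kk.
  by rewrite -[k]conjg1 k1 ?group1 // scale1r.
have nzfix : rfix_mx rH N != 0.
  rewrite -(map_mx_eq0 j) map_rfix_mx; apply: contraNneq nzv => fix0.
  have : (v <= rfix_mx rM N)%MS by apply/rfix_mxP.
  by rewrite fix0 => /submx0null->.
have nNH : (N <| H)%g by apply: normalS nNG.
have /mx_irrP[_ /(_ _ (normal_rfix_mx_module rH nNH) nzfix)] := irr.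
rewrite -sub1mx => /rfix_mxP fix1.
have sNker : N \subset rker rH.
  apply/subsetP=> k Nk; apply/rkerP; split; first exact: (subsetP sNH).
  by rewrite -[LHS]mul1mx fix1.
have N1 := noN N nNG sNK sNker; move=> k Kk k1; apply/set1gP; rewrite -N1.
by apply/NsP.
Qed.

(** * Decomposition into conjugate eigenspaces *)

Section Structure.

Variable lam : gT -> M.
Hypotheses (lamP : group_char K lam) (cf : corefree lam).
Hypotheses (irr : mx_irreducible rH) (nzP : proj lam != 0).

Lemma reprH C : C \in rcosets I H -> repr C \in H.
Proof.
case/rcosetsP=> x Hx ->; case: repr_rcosetP => y /(subsetP pinertia_sub) Hy.
by rewrite groupM.
Qed.

Lemma proj_conj_ortho C C' a a' : C \in rcosets I H -> C' \in rcosets I H ->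
    a \in A -> a' \in A -> (C, a) != (C', a') ->
  proj (conj_char lam (repr C) a) *m proj (conj_char lam (repr C') a') = 0.
Proof.
move=> IC IC' Aa Aa' neq; have [HC HC'] := (reprH IC, reprH IC').
have charP C1 a1 : C1 \in rcosets I H -> group_char K (conj_char lam (repr C1) a1).
  by move=> IC1; apply: conj_charP => //; rewrite (subsetP sHG) ?reprH.
have [h /andP[Kh nh] | all_eq] :=
  pickP [pred h in K | conj_char lam (repr C) a h != conj_char lam (repr C') a' h].
  exact: (proj_orthogonal rK (charP _ _ IC) (charP _ _ IC') Kh nh).
have [] := @conj_char_inj lam (repr C) (repr C') a a' lamP cf HC HC' Aa Aa'.
  by move=> h Kh; have := all_eq h; rewrite inE Kh => /negbFE/eqP.
have rc C1 : C1 \in rcosets I H -> (I :* repr C1)%g = C1.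
  by case/rcosetsP=> x Hx ->; rewrite rcoset_repr.
rewrite !rc // => eC ea; case/eqP: neq; rewrite eC ea //.
by rewrite eC.
Qed.

(** The kernel of 1 - Q contains all the twists of the lam-eigenspace, hence is everything. *)
Lemma sum_proj : \sum_(C in rcosets I H) \sum_(a in A) proj (conj_char lam (repr C) a) = 1%:M.
Proof.
set Q := \sum_(C in _) _.
have PQ C a : C \in rcosets I H -> a \in A ->
    proj (conj_char lam (repr C) a) *m Q = proj (conj_char lam (repr C) a).
  move=> IC Aa; rewrite /Q pair_big_dep mulmx_sumr /= (bigD1 (C, a)) ?IC //=.
  rewrite big1 ?addr0 => [|[C' a'] /andP[/andP[IC' Aa'] neq]].
    by rewrite proj_idem //; apply: conj_charP => //; rewrite (subsetP sHG) ?reprH.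
  by rewrite proj_conj_ortho //= eq_sym.
suff: row_full (kermx (1%:M - Q)).
  by rewrite -sub1mx => /sub_kermxP; rewrite mul1mx => /subr0_eq.
apply: (stable_full irr nzP (stable_proj lamP)) => C a IC Aa; apply/sub_kermxP.
have eigP : eigen lam (proj lam) by apply: eigen_projr.
have cP : group_char K (conj_char lam (repr C) a).
  by apply: conj_charP => //; rewrite (subsetP sHG) ?reprH.
have /submxP[Y ->] := (eigen_sub rK char0 _ cP).1 (eigen_twist eigP (reprH IC) Aa).
by rewrite -mulmxA mulmxBr mulmx1 PQ // subrr mulmx0.
Qed.

(** Clifford's theorem over F: the constituents on K are conjugate under H and Galois. *)
Lemma eigen_constituent k mu (U : 'M_(k, m)) : group_char K mu -> U != 0 -> eigen mu U ->
  exists x a, [/\ x \in H, a \in A & {in K, mu =1 conj_char lam x a}].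
Proof.
move=> muP nzU eigU; apply: NNPP => no; case/eqP: nzU.
rewrite -[U]mulmx1 -sum_proj mulmx_sumr big1 // => C IC.
rewrite mulmx_sumr big1 // => a Aa; have HC := reprH IC.
have charC : group_char K (conj_char lam (repr C) a) by apply: conj_charP; rewrite ?(subsetP sHG).
have [h /andP[Kh nh] | all_eq] := pickP [pred h in K | mu h != conj_char lam (repr C) a h].
  have /submxP[Y ->] := (eigen_sub rK char0 _ muP).1 eigU.
  by rewrite -mulmxA (proj_orthogonal rK muP charC Kh nh) mulmx0.
case: no; exists (repr C), a; split=> // h Kh.
by have := all_eq h; rewrite inE Kh => /negbFE/eqP.
Qed.

Lemma natr_inj k l : k%:R = l%:R :> M -> k = l.
Proof.
wlog le_kl : k l / (k <= l)%N.
  by move=> IH e_kl; case/orP: (leq_total k l) => le_kl; [apply: IH | apply/esym/IH].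
move=> e_kl; apply/eqP; rewrite eqn_leq le_kl -subn_eq0.
by rewrite -((pcharf0P M).1 char0) natrB // e_kl subrr eqxx.
Qed.

(** Trace of the identity, as a sum over [H : I] |A| eigenspaces of equal rank. *)
Lemma degree_proj : m = (#|H : I| * #|A| * \rank (proj lam))%N.
Proof.
apply: natr_inj; rewrite -[LHS]mxtrace1 -sum_proj raddf_sum /=.
rewrite (eq_bigr (fun _ => (#|A| * \rank (proj lam))%:R)) => [|C IC].
  by rewrite sumr_const -mulrnA mulnC mulnA.
rewrite raddf_sum /= (eq_bigr (fun _ => (\rank (proj lam))%:R)) => [|a Aa].
  by rewrite sumr_const -mulrnA mulnC.
rewrite mxtrace_proj ?rank_proj_conj ?reprH //.
by apply: conj_charP => //; rewrite (subsetP sHG) ?reprH.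
Qed.

Lemma rank_proj_gt0 : (0 < \rank (proj lam))%N.
Proof. by rewrite lt0n mxrank_eq0. Qed.

(** A nonzero stable subspace of smaller rank would have too few distinct twists to span. *)
Lemma rank_proj_le k (U : 'M_(k, m)) : U != 0 -> stable U -> (\rank (proj lam) <= \rank U)%N.
Proof.
move=> nzU stU; have := rank_stable irr nzU stU; rewrite {1}degree_proj leq_pmul2l //.
have [m_gt0 _] := (mx_irrP _).1 irr; move: m_gt0; rewrite degree_proj.
by rewrite muln_gt0 => /andP[].
Qed.

Lemma proj_row : exists2 v : 'rV_m, v != 0 & eigen lam v.
Proof.
exists (nz_row (proj lam)); first by rewrite nz_row_eq0.
by apply/eigen_sub; rewrite ?nz_row_sub.
Qed.

Lemma rank_proj1 : \rank (proj lam) = 1%N <-> has_cocycle lam.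
Proof.
split=> [|[f fP]]; first exact: line_cocycle.
have [v nzv eigv] := proj_row.
have [w [nzw _ wP]] := cocycle_line lamP sub_pinertia (subxx I) fP nzv eigv.
apply/eqP; rewrite eqn_leq rank_proj_gt0 andbT.
have <-: \rank w = 1%N by rewrite rank_rV nzw.
by apply: rank_proj_le => // x Ix; rewrite wP // scalemx_sub.
Qed.

(** The line obtained by descent to J and its translate by one element outside J span a stable
    subspace. *)
Lemma rank_proj_le2 : (\rank (proj lam) <= 2)%N.
Proof.
have [J [f [sKJ sJI fP i2]]] := cocycle_index2 lamP.
have [v nzv eigv] := proj_row.
have [w [nzw _ wP]] := cocycle_line lamP sKJ sJI fP nzv eigv.
have [y0 Iy0 y0P] : exists2 y0, y0 \in I & forall y, y \in I -> y \in J \/ (y * y0^-1)%g \in J.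
  have [sIJ | /subsetPn[g Ig Jg]] := boolP (I \subset J).
    by exists 1%g => // y /(subsetP sIJ); left.
  exists g => // y Iy; have [Jy | Jy] := boolP (y \in J); [by left | right].
  by apply: i2; rewrite ?groupV.
set U := col_mx w (twist y0 (frob y0) w).
have wU y : y \in I -> (twist y (frob y) w <= U)%MS.
  move=> Iy; rewrite -addsmxE; have [Jy | Jy] := y0P y Iy.
    by rewrite wP // scalemx_sub // addsmxSl.
  rewrite -{1 2}(mulgKV y0 y) -twist_frobM ?(subsetP sJI _ Jy) // wP // twistZ.
  by rewrite scalemx_sub // addsmxSr.
have stabU : stable U.
  move=> x Ix; rewrite {1}/U /twist map_col_mx mul_col_mx col_mx_sub.
  rewrite -!/(twist _ _ _) twist_frobM ?wU ?groupM //.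
apply: leq_trans (rank_proj_le _ stabU) (rank_leq_row _).
apply: contraNneq nzw => U0; have : (w <= U)%MS by rewrite -addsmxE addsmxSl.
by rewrite U0 => /submx0null->.
Qed.

Section Frobenius.

(** True over an algebraically closed field and over F(chi). Every Galois conjugate of lam is then
    an H-conjugate, and the cosets of K alone index the eigenspaces. *)
Hypothesis frob_onto : forall a, a \in A -> exists2 x, x \in I & frob x = a.

Lemma reprHK C : C \in rcosets K H -> repr C \in H.
Proof.
case/rcosetsP=> x Hx ->; case: repr_rcosetP => y /(subsetP sKH) Hy.
by rewrite groupM.
Qed.

Lemma conj_char1 x h : conj_char lam x 1%g h = lam (h ^ x^-1)%g.
Proof. exact: (gd1 D). Qed.

Lemma conj_char1P x : x \in H -> group_char K (conj_char lam x 1%g).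
Proof. by move=> Hx; apply: conj_charP; rewrite ?(subsetP sHG). Qed.

Lemma conj_char1_repr x : x \in H ->
  {in K, conj_char lam x 1%g =1 conj_char lam (repr (K :* x)%g) 1%g}.
Proof.
move=> Hx h Kh; rewrite !conj_char1; case: repr_rcosetP => k Kk.
rewrite invMg conjgM; congr lam; apply/esym/conjg_fixP/commgP/(centsP abK).
  exact: memKJ Kh (groupVr (subsetP sHG x Hx)).
by rewrite groupV.
Qed.

Lemma conj_char1_sep C C' : C \in rcosets K H -> C' \in rcosets K H -> C != C' ->
  exists2 h, h \in K & conj_char lam (repr C) 1%g h != conj_char lam (repr C') 1%g h.
Proof.
move=> KC KC' neq; have [HC HC'] := (reprHK KC, reprHK KC').
have rc C1 : C1 \in rcosets K H -> (K :* repr C1)%g = C1.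
  by case/rcosetsP=> x Hx ->; rewrite rcoset_repr.
have [h /andP[Kh nh] | all_eq] :=
  pickP [pred h in K | conj_char lam (repr C) 1%g h != conj_char lam (repr C') 1%g h].
  by exists h.
have {}all_eq : {in K, conj_char lam (repr C) 1%g =1 conj_char lam (repr C') 1%g}.
  by move=> h Kh; have := all_eq h; rewrite inE Kh => /negbFE/eqP.
case/eqP: neq; rewrite -(rc _ KC) -(rc _ KC'); apply/rcoset_eqP; rewrite mem_rcoset.
have Hz : (repr C * (repr C')^-1)%g \in H by rewrite groupM ?groupV.
have Gz := subsetP sHG _ Hz.
have [Iz fz] : (repr C * (repr C')^-1)%g \in I /\ frob (repr C * (repr C')^-1)%g = 1%g.
  apply: frob_eq => //; apply: (corefree_power lamP cf) => // h Kh.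
  rewrite -(gd_root D) ?char_root // (gd1 D).
  have := all_eq _ (memKJ Kh (subsetP sHG _ HC)); rewrite !conj_char1 conjgK => ->.
  by rewrite conjgM.
by rewrite -frob1 // fz.
Qed.

Lemma sum_proj_conj : \sum_(C in rcosets K H) proj (conj_char lam (repr C) 1%g) = 1%:M.
Proof.
set Q := \sum_(C in _) _.
have PQ C : C \in rcosets K H ->
    proj (conj_char lam (repr C) 1%g) *m Q = proj (conj_char lam (repr C) 1%g).
  move=> KC; rewrite /Q mulmx_sumr (bigD1 C) //= (proj_idem rK char0 (conj_char1P (reprHK KC))).
  rewrite big1 ?addr0 // => C' /andP[KC' neq].
  have [|h Kh nh] := conj_char1_sep KC KC'; first by rewrite eq_sym.
  exact: (proj_orthogonal rK (conj_char1P (reprHK KC)) (conj_char1P (reprHK KC')) Kh nh).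
suff: row_full (kermx (1%:M - Q)).
  by rewrite -sub1mx => /sub_kermxP; rewrite mul1mx => /subr0_eq.
apply: (stable_full irr nzP (stable_proj lamP)) => C a IC Aa; apply/sub_kermxP.
have eigP : eigen lam (proj lam) by apply: eigen_projr.
have HC := reprH IC; have [x Ix fx] := frob_onto Aa.
have Hx := subsetP pinertia_sub x Ix.
have KD : (K :* (x^-1 * repr C))%g \in rcosets K H.
  by apply/rcosetsP; exists (x^-1 * repr C)%g; rewrite ?groupM ?groupV.
have eigT : eigen (conj_char lam (repr (K :* (x^-1 * repr C))%g) 1%g) (twist (repr C) a (proj lam)).
  move=> h Kh; rewrite (eigen_twist eigP HC Aa) //; congr (_ *: _).
  rewrite -conj_char1_repr ?groupM ?groupV // conj_char1 invMg invgK conjgM.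
  have Kh' : (h ^ (repr C)^-1)%g \in K by rewrite memKJ ?groupV ?(subsetP sHG).
  by rewrite conj_charE ?(subsetP sHG) // (frobJ Ix Kh') fx (group_charX _ lamP).
have /submxP[Y ->] := (eigen_sub rK char0 _ (conj_char1P (reprHK KD))).1 eigT.
by rewrite -mulmxA mulmxBr mulmx1 PQ // subrr mulmx0.
Qed.

(** A multiple of the character induced from lam: H/K permutes the conjugates of lam freely, so that
    g outside K moves every eigenspace. *)
Lemma mxtrace_induced g : g \in H ->
  \tr (rM g) = (if g \in K then \sum_(C in rcosets K H) lam (g ^ (repr C)^-1)%g else 0)
               * (\rank (proj lam))%:R.
Proof.
move=> Hg; rewrite -[rM g]mul1mx -sum_proj_conj mulmx_suml raddf_sum /=.
case: ifP => [Kg | notKg].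
  rewrite mulr_suml; apply: eq_bigr => C KC; have HC := reprHK KC.
  have eigC : eigen (conj_char lam (repr C) 1%g) (proj (conj_char lam (repr C) 1%g)).
    by apply: eigen_projr; apply: conj_char1P.
  have /= -> := eigC g Kg; rewrite mxtraceZ conj_char1; congr (_ * _).
  by rewrite (mxtrace_proj rK char0 (conj_char1P HC)) rank_proj_conj.
rewrite mul0r big1 // => C KC; have HC := reprHK KC.
have charC := conj_char1P HC; set mu := conj_char lam (repr C) 1%g in charC *.
(* The trace of P g is that of P g P, and P g lies in another eigenspace. *)
rewrite -(proj_idem rK char0 charC) -mulmxA mxtrace_mulC.
have eigC : eigen mu (proj mu) by apply: eigen_projr.
have HCg : (repr C * g)%g \in H by rewrite groupM.
have KC' : (K :* (repr C * g))%g \in rcosets K H by apply/rcosetsP; exists (repr C * g)%g.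
have eigCg : eigen (conj_char lam (repr (K :* (repr C * g))%g) 1%g) (proj mu *m rM g).
  have -> : proj mu *m rM g = twist g 1%g (proj mu).
    by rewrite /twist (map_gd1 D).
  move=> h Kh; rewrite (eigen_twist eigC Hg (group1 A)) //; congr (_ *: _).
  by rewrite -conj_char1_repr // /mu /conj_char !(gd1 D) invMg conjgM.
have /submxP[Y ->] := (eigen_sub rK char0 _ (conj_char1P (reprHK KC'))).1 eigCg.
have neq : (K :* (repr C * g))%g != C.
  have CE : (K :* repr C)%g = C by case/rcosetsP: KC => x Hx ->; rewrite rcoset_repr.
  apply: contraFneq notKg => eC; have : (repr C * g)%g \in (K :* repr C)%g.
    by rewrite CE -{2}eC rcoset_refl.
  rewrite mem_rcoset => Kc; have := memJ_norm (repr C * g * (repr C)^-1)%g (subsetP nKH _ HC).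
  by rewrite Kc conjgE !mulgA mulVg mul1g mulgKV.
have [h Kh nh] := conj_char1_sep KC' KC neq.
have {}nh := proj_orthogonal rK (conj_char1P (reprHK KC')) charC Kh nh.
by rewrite -mulmxA nh mulmx0 mxtrace0.
Qed.

End Frobenius.

End Structure.

End Representation.

Lemma mxtrace_proj_map m (rH : mx_representation F H m) lam :
  \tr (proj (subg_repr (map_repr j rH) sKH) lam)
    = #|K|%:R^-1 * \sum_(h in K) lam h^-1%g * j (\tr (rH h)).
Proof.
rewrite mxtraceZ raddf_sum /=; congr (_ * _); apply: eq_bigr => h Kh.
by rewrite mxtraceZ /= trace_map_mx.
Qed.

Lemma proj_eq0 m (rH : mx_representation F H m) lam : group_char K lam ->
  (proj (subg_repr (map_repr j rH) sKH) lam == 0)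
    = (\tr (proj (subg_repr (map_repr j rH) sKH) lam) == 0).
Proof.
move=> lamP; rewrite mxtrace_proj //; have [-> | nz] := eqVneq (proj _ lam) 0.
  by rewrite mxrank0 eqxx.
by rewrite ((pcharf0P M).1 char0) mxrank_eq0 (negPf nz).
Qed.

(** Descent from the regular representation to submodules and quotients: the trace of the projector
    is additive, so one of the two retains lam. *)
Lemma irreducible_over lam : group_char K lam ->
  exists m (rH : mx_representation F H m),
    mx_irreducible rH /\ proj (subg_repr (map_repr j rH) sKH) lam != 0.
Proof.
move=> lamP; suff IH m0 m (rH : mx_representation F H m) : (m <= m0)%N ->
    proj (subg_repr (map_repr j rH) sKH) lam != 0 ->
    exists m (rH : mx_representation F H m),
      mx_irreducible rH /\ proj (subg_repr (map_repr j rH) sKH) lam != 0.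
  apply: (IH _ _ (regular_repr F H) (leqnn _)).
  (* The projector has coefficient 1/|K| at the identity of the group algebra. *)
  apply/eqP=> P0; have := congr1 (@gring_proj M gT H 1%g) P0.
  rewrite linear0 linearZ linear_sum (bigD1 1%g) //= big1 => [|h /andP[Kh nh1]].
    rewrite addr0 invg1 lamP.1 scale1r map_regular_repr gring_projE ?group1 // eqxx.
    move/eqP; rewrite scaler_eq0 invr_eq0 (negPf (char0_neq0 char0 (cardG_gt0 K))).
    by move/eqP/matrixP/(_ 0 0)/eqP; rewrite !mxE oner_eq0.
  rewrite linearZ /= map_regular_repr gring_projE ?group1 ?(subsetP sKH) //.
  by rewrite eq_sym (negPf nh1) scaler0.
elim: m0 m rH => [|m0 IH] m rH le_m nzP.
  case/eqP: nzP; apply/matrixP=> -[i lti]; by have := leq_trans lti le_m.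
have [[U /and4P[modU _ nzU ltU]] | simp] := classic (mxnonsimple rH 1%:M).
  rewrite mxrank1 in ltU.
  pose rU := submod_repr modU; pose rF := factmod_repr modU.
  have tr_sum : \tr (proj (subg_repr (map_repr j rH) sKH) lam)
      = \tr (proj (subg_repr (map_repr j rU) sKH) lam)
        + \tr (proj (subg_repr (map_repr j rF) sKH) lam).
    rewrite !mxtrace_proj_map -mulrDr -big_split /=; congr (_ * _).
    by apply: eq_bigr => h Kh; rewrite -mulrDr -rmorphD mxtrace_sub_fact_mod.
  have [PU0 | nzU'] := eqVneq (proj (subg_repr (map_repr j rU) sKH) lam) 0.
    apply: (IH _ rF).
      rewrite mxrank_coker -ltnS (leq_trans _ le_m) // ltn_subrL lt0n mxrank_eq0 nzU.
      exact: leq_ltn_trans ltU.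
    apply: contra nzP; rewrite !proj_eq0 // tr_sum PU0 mxtrace0 add0r //.
  apply: (IH _ rU) => //; by rewrite -ltnS (leq_trans ltU).
exists m, rH; split=> //; apply/mxsimpleP; split=> //; first exact: mxmodule1.
apply: contraNneq nzP => one0.
by rewrite -[proj _ _]mulmx1 -(map_mx1 j) one0 map_mx0 mulmx0.
Qed.

End Inertia.

(** * Cyclotomic extensions *)

Section Cyclotomic.
Local Open Scope ring_scope.

Lemma pchar0_rmorph (F L : fieldType) (f : {rmorphism F -> L}) :
  [pchar F] =i pred0 -> [pchar L] =i pred0.
Proof. by move=> c0 p; rewrite (fmorph_pchar f) c0. Qed.

Lemma prim_root_closed (L : closedFieldType) n : (0 < n)%N -> [pchar L] =i pred0 ->
  exists z : L, n.-primitive_root z.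
Proof.
move=> n_gt0 c0; pose p : {poly L} := 'X^n - 1; have [r Dp] := closed_field_poly_normal p.
rewrite (monicP _) ?monicXnsubC // scale1r in Dp.
have rn1: all n.-unity_root r by apply/allP=> z; rewrite -root_prod_XsubC -Dp.
have sz_r: (n < (size r).+1)%N by rewrite -(size_prod_XsubC r id) -Dp size_XnsubC.
have [|z] := hasP (has_prim_root n_gt0 rn1 _ sz_r); last by exists z.
by rewrite -separable_prod_XsubC -Dp separable_Xn_sub_1 // ((pcharf0P L).1 c0) -lt0n.
Qed.

Lemma deriv_double_root (M : fieldType) (A B C : {poly M}) w : root A w -> root B w ->
  (A * (B * C))^`().[w] = 0.
Proof.
rewrite !rootE => /eqP Aw /eqP Bw.
by rewrite !derivM !(hornerD, hornerM) Aw Bw !(mul0r, mulr0, addr0).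
Qed.

Lemma prod_Cyclotomic_map (M : fieldType) d : (0 < d)%N ->
  \prod_(d' <- divisors d) map_poly intr 'Phi_d' = 'X^d - 1 :> {poly M}.
Proof.
move=> d_gt0; rewrite -rmorph_prod prod_Cyclotomic //.
by rewrite rmorphB rmorph1 /= map_polyXn.
Qed.

(** If w had smaller order, it would also be a root of another cyclotomic factor of X^n - 1, hence a
    double root of this separable polynomial. *)
Lemma root_Cyclotomic_prim (M : fieldType) n (w : M) : (0 < n)%N -> [pchar M] =i pred0 ->
  root (map_poly intr 'Phi_n) w -> n.-primitive_root w.
Proof.
move=> n_gt0 c0 rw.
have prodM := prod_Cyclotomic_map M.
have in_n : n \in divisors n by rewrite -dvdn_divisors.
have wn : w ^+ n = 1.
  have : root ('X^n - 1) w by rewrite -prodM // (big_rem n) //= rootM rw.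
  by rewrite rootE !hornerE subr_eq0 => /eqP.
have [d prim_w dv_n] := prim_order_exists n_gt0 wn.
have [<- // | neq_dn] := eqVneq d n.
have d_gt0 := prim_order_gt0 prim_w.
have : root ('X^d - 1) w by rewrite rootE !hornerE prim_expr_order ?subrr.
rewrite -prodM // rootE horner_prod prodf_seq_eq0 => /hasP[d' + /= rw'].
rewrite -dvdn_divisors // => dv_d'.
have in_d' : d' \in rem n (divisors n).
  rewrite mem_rem_uniq ?divisors_uniq // inE -dvdn_divisors // (dvdn_trans dv_d') // andbT.
  by apply: contraNneq neq_dn => Dn; rewrite eqn_dvd dv_n -Dn.
have Dfac := prodM n n_gt0; rewrite (big_rem n) //= (big_rem d') //= in Dfac.
have : ('X^n - 1 : {poly M})^`().[w] = 0 by rewrite -Dfac deriv_double_root.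
rewrite !derivE subr0 hornerMn hornerXn.
have nzw : w != 0 by apply: contra_eq_neq wn => ->; rewrite expr0n gtn_eqF // eq_sym oner_neq0.
move/eqP; rewrite -mulr_natr mulf_eq0 (negPf (expf_neq0 _ nzw)) /=.
by rewrite ((pcharf0P M).1 c0) -[n == _]negbK -lt0n n_gt0.
Qed.

Lemma minimal_annihilator (F L : fieldType) (iota : {rmorphism F -> L}) (z : L) (p : {poly F}) :
    p != 0 -> root (map_poly iota p) z ->
  exists r : {poly F}, [/\ r != 0, root (map_poly iota r) z
    & forall q, root (map_poly iota q) z -> q != 0 -> (size r <= size q)%N].
Proof.
move: {2}(size p) (leqnn (size p)) => k; elim: k p => [|k IH] p.
  by rewrite leqn0 size_poly_eq0 => ->.
move=> sz_p nz_p rz; have [[q [rq nz_q lt_qp]] | no] := classic (exists q : {poly F},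
    [/\ root (map_poly iota q) z, q != 0 & (size q < size p)%N]).
  by apply: (IH q) => //; rewrite -ltnS (leq_trans lt_qp).
exists p; split=> // q rq nz_q; rewrite leqNgt; apply/negP=> lt_qp.
by case: no; exists q.
Qed.

(** F(zeta) comes with an embedding in L, which relates Galois theory over F to representations over
    L. *)
Lemma cyclotomic_extension (F : fieldType) (L : closedFieldType) (iota : {rmorphism F -> L}) n :
    (0 < n)%N -> [pchar F] =i pred0 ->
  exists (M : splittingFieldType F) (emb : {rmorphism M -> L}) (z : M),
    [/\ n.-primitive_root z, <<1; z>>%VS = fullv, galois 1 {:M},
        forall a : F, emb a%:A = iota a
      & forall r : {poly F}, irreducible_poly r -> r %| map_poly intr 'Phi_n ->
          (size r).-1 = \dim {:M}].
Proof.
move=> n_gt0 c0; have cL := pchar0_rmorph iota c0.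
have [zL prim_zL] := prim_root_closed n_gt0 cL.
have nzX1 : ('X^n - 1 : {poly F}) != 0 by rewrite -size_poly_gt0 size_XnsubC.
have rzL : root (map_poly iota ('X^n - 1)) zL.
  by rewrite rmorphB rmorph1 /= map_polyXn rootE !hornerE prim_expr_order ?subrr.
have [p [nz_p rp min_p]] := minimal_annihilator nzX1 rzL.
have irr_p : irreducible_poly p by apply/(subfx_irreducibleP rp nz_p).
pose M0 : fieldExtType F := SubFieldExtType rp irr_p.
pose emb : {rmorphism M0 -> L} := @subfx_inj F L iota zL p.
pose z : M0 := subfx_root iota zL p.
have emb_z : emb z = zL by apply: subfx_inj_root.
have prim_z : n.-primitive_root z by rewrite -(fmorph_primitive_root emb) emb_z.
have full_z : <<1; z>>%VS = fullv.
  apply/vspaceP=> x; rewrite memvf; have [q ->] := subfxEroot rp nz_p x.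
  by apply: mempx_Fadjoin; apply/polyOver1P; exists q.
have split_X : splittingFieldFor 1 ('X^n - 1 : {poly M0}) {:M0}.
  exists [seq z ^+ i | i <- index_iota 0 n].
    by rewrite big_map (factor_Xn_sub_1 prim_z) eqpxx.
  apply/eqP; rewrite eqEsubv subvf -full_z; apply/FadjoinP; rewrite subv_adjoin_seq.
  split=> //; apply/seqv_sub_adjoin/mapP; exists (1 %% n)%N.
    by rewrite mem_index_iota /= ltn_mod.
  by rewrite (prim_expr_mod prim_z) expr1.
have polyX : 'X^n - 1 \is a polyOver (1%AS : {subfield M0}).
  by rewrite rpredB ?rpred1 ?rpredX ?polyOverX.
pose M : splittingFieldType F :=
  HB.pack M0 (FieldExt_isSplittingField.Build F M0 (ex_intro2 _ _ ('X^n - 1) polyX split_X)).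
exists M, emb, z; split=> //.
- apply/splitting_galoisField; exists ('X^n - 1); split=> //.
  by apply: separable_Xn_sub_1; rewrite (prim_root_natf_neq0 prim_z).
- by move=> a; apply: subfx_inj_base.
move=> r irr_r dv_r.
have dvX : r %| 'X^n - 1.
  rewrite -prod_Cyclotomic_map // (big_rem n) /= -?dvdn_divisors //.
  exact: dvdp_mulr.
(* An irreducible factor r of the cyclotomic polynomial has a root among the powers of z. It is
   primitive, so it generates M, and its minimal polynomial divides r. *)
have : map_poly (in_alg M0) r %| \prod_(0 <= i < n) ('X - (z ^+ i)%:P).
  rewrite (factor_Xn_sub_1 prim_z).
  have -> : 'X^n - 1 = map_poly (in_alg M0) ('X^n - 1).
    by rewrite rmorphB rmorph1 /= map_polyXn.
  by rewrite dvdp_map.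
case/dvdp_prod_XsubC=> m; case: (mask m _) => [|i s] eq_rM.
  have [sz_r _] := irr_r; have := eqp_size eq_rM.
  by rewrite big_nil size_poly1 size_map_poly => sz1; rewrite sz1 in sz_r.
have rw : root (map_poly (in_alg M0) r) (z ^+ i).
  by rewrite (eqp_root eq_rM) big_cons rootM root_XsubC eqxx.
set w := z ^+ i in rw.
have cM := pchar0_rmorph (in_alg M0) c0.
have prim_w : n.-primitive_root w.
  apply: (root_Cyclotomic_prim n_gt0 cM).
  have -> : map_poly intr 'Phi_n = map_poly (in_alg M0) (map_poly intr 'Phi_n) :> {poly M0}.
    by rewrite -map_poly_comp; apply: eq_map_poly => k /=; rewrite scaler_int.
  have /dvdpP[t ->] : map_poly (in_alg M0) r %| map_poly (in_alg M0) (map_poly intr 'Phi_n).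
    by rewrite dvdp_map.
  by rewrite rootM rw orbT.
have full_w : <<1; w>>%VS = fullv.
  apply/eqP; rewrite eqEsubv subvf -full_z; apply/FadjoinP; rewrite subv_adjoin.
  have [k ->] := prim_rootP prim_w (prim_expr_order prim_z).
  by split=> //; rewrite rpredX ?memv_adjoin.
have /polyOver1P[s0 Ds0] := minPolyOver 1 w.
have dv_s0 : s0 %| r.
  rewrite -(dvdp_map (in_alg M0)) -Ds0 minPoly_dvdp //.
  by apply/polyOver1P; exists r.
have sz_s0 : size s0 = (\dim {:M0}).+1.
  rewrite -(size_map_poly (in_alg M0)) -Ds0 size_minPoly adjoin_degreeE full_w.
  by rewrite dimv1 divn1.
have [_ irr] := irr_r; have := irr s0; rewrite sz_s0 => /(_ _ dv_s0) eqs.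
rewrite -(eqp_size (eqs _)) ?sz_s0 // eqSS -lt0n.
by rewrite adim_gt0.
Qed.

End Cyclotomic.

Section GaloisData.
Local Open Scope ring_scope.

Variables (F : fieldType) (M : splittingFieldType F) (n : nat) (z : M).
Hypotheses (prim_z : n.-primitive_root z) (full_z : <<1; z>>%VS = fullv).
Hypotheses (galM1 : galois 1 {:M}) (c0 : [pchar F] =i pred0).

Definition gal_mor (a : gal_of {:M}) : {rmorphism M -> M} := (a : 'AEnd(M)).

(** The cyclotomic character; [gal_expP] shows that the default 0 is not reached. *)
Definition gal_exp (a : gal_of {:M}) : nat :=
  if [pick i : 'I_n | a z == z ^+ i] is Some i then i else 0%N.

Lemma gal_expP a : gal_mor a z = z ^+ gal_exp a.
Proof.
rewrite /gal_exp; case: pickP => [i /eqP // | no].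
have an : (gal_mor a z) ^+ n = 1 by rewrite -rmorphXn (prim_expr_order prim_z) rmorph1.
by have [i Di] := prim_rootP prim_z an; have /eqP := no i.
Qed.

Lemma gal_mor_alg a (c : F) : gal_mor a c%:A = c%:A.
Proof. by rewrite /= linearZ rmorph1. Qed.

Lemma gal_mor_inj a b : gal_mor a z = gal_mor b z -> a = b.
Proof.
move=> eq_z; apply/eqP/gal_eqP => u _.
have /Fadjoin_polyP[p /polyOver1P[q ->] ->] : u \in <<1; z>>%VS by rewrite full_z memvf.
have E c : gal_mor c (map_poly (in_alg M) q).[z] = (map_poly (in_alg M) q).[gal_mor c z].
  rewrite -horner_map -map_poly_comp; congr (_.[_]); apply: eq_map_poly => x.
  exact: gal_mor_alg.
by rewrite [LHS](E a) eq_z -E.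
Qed.

Lemma gal_datum (B : {group gal_of {:M}}) :
  galois_datum (vsval : {rmorphism subvs_of (fixedField B) -> M}) B gal_mor gal_exp n z.
Proof.
split=> [| | a _ | a b _ _ x | a b _ _ e_ab | x].
- exact: pchar0_rmorph (in_alg M) c0.
- exact: prim_z.
- exact: gal_expP.
- exact: galM (memvf x).
- apply: gal_mor_inj; rewrite !gal_expP; apply/eqP.
  by rewrite (eq_prim_root_expr prim_z); apply/eqP.
split=> [fix_x | [y ->] a Ba].
  have Ex : x \in fixedField B by apply/fixedFieldP; rewrite ?memvf.
  by exists (Subvs Ex).
exact: (fixedFieldP (memvf _) (subvsP y) a Ba).
Qed.

Lemma gal_datum1 :
  galois_datum (in_alg M : {rmorphism F -> M}) 'Gal({:M} / 1)%G gal_mor gal_exp n z.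
Proof.
have [d1 d2 d3 d4 d5 d6] := gal_datum 'Gal({:M} / 1)%G.
split=> // x; rewrite d6; have /galois_fixedField fixE := galM1.
split=> [[y ->] | [y ->]].
  case: y => y /=; rewrite fixE => /vlineP[k ->]; by exists k.
have E1 : y%:A \in fixedField 'Gal({:M} / 1) by rewrite fixE memvZ ?mem1v.
by exists (Subvs E1).
Qed.

Lemma card_gal : #|'Gal({:M} / 1)| = \dim {:M}.
Proof. by rewrite -(galois_dim galM1) dimv1 divn1. Qed.

End GaloisData.

(** L over itself: with the single exponent 1, the inertia group of a self-centralizing K is K. *)
Lemma trivial_datum (L : fieldType) (n : nat) (z : L) (aT : finGroupType) :
  [pchar L]%R =i pred0 -> (n.-primitive_root z)%R ->
  galois_datum (idfun : {rmorphism L -> L}) (1%G : {group aT}) (fun _ => idfun : {rmorphism L -> L})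
    (fun _ => 1%N) n z.
Proof.
move=> c0 prim; split=> [//|//| a _ |//| a b /set1gP-> /set1gP-> // | x]; first by rewrite expr1.
by split=> // _; exists x.
Qed.

(** * Schur indices and degrees *)

Section CorefreeConstituents.
Local Open Scope ring_scope.

Variables (F M : fieldType) (j : {rmorphism F -> M}) (aT : finGroupType).
Variables (A : {group aT}) (sg : aT -> {rmorphism M -> M}) (e : aT -> nat).
Variables (p n : nat) (zeta : M) (D : galois_datum j A sg e (p ^ n) zeta).
Variables (gT : finGroupType) (G H K : {group gT}).
Hypotheses (sKH : K \subset H) (sHG : H \subset G) (abK : abelian K).
Hypotheses (derG : [~: G, G]%g \subset K) (expK : exponent K = (p ^ n)%N).

Lemma corefree_constituent m (rH : mx_representation F H m) : mx_irreducible rH ->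
    (forall N : {group gT}, (N <| G)%g -> N \subset K -> N \subset rker rH -> N :=: 1%g) ->
  exists lam, [/\ group_char K lam, corefree G K lam
    & proj (subg_repr (map_repr j rH) sKH) lam != 0].
Proof.
move=> irr noN; have [m_gt0 _] := (mx_irrP _).1 irr.
have [lam [v [nzv lamP eigv]]] :=
  eigenvector_exists (subg_repr (map_repr j rH) sKH) (gd_char0 D) m_gt0 abK expK (gd_prim D).
exists lam; split=> //; first exact: (eigen_corefree sHG derG lamP irr noN nzv eigv).
apply: contraNneq nzv => P0.
have := eigen_proj (gd_char0 D) lamP eigv; rewrite P0 mulmx0 => <-; exact: eqxx.
Qed.

End CorefreeConstituents.

Lemma faithful_core (F : fieldType) (gT : finGroupType) (G K : {group gT}) m
    (rG : mx_representation F G m) : mx_faithful rG ->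
  forall N : {group gT}, (N <| G)%g -> N \subset K -> N \subset rker rG -> N :=: 1%g.
Proof. by move=> ff N _ _ sN; apply/trivgP; apply: subset_trans ff. Qed.

Lemma core_free_core (F : fieldType) (gT : finGroupType) (G K : {group gT}) m
    (rK : mx_representation F K m) : core_free G (rker rK) ->
  forall N : {group gT}, (N <| G)%g -> N \subset K -> N \subset rker rK -> N :=: 1%g.
Proof.
move=> /eqP cf N /andP[_ nNG] _ sN; apply/trivgP; rewrite -cf.
by rewrite gcore_max.
Qed.

Lemma emb_adjoin (F : fieldType) (M : fieldExtType F) (L : fieldType) (emb : {rmorphism M -> L})
    (S : {pred L}) (U : {subfield M}) (rs : seq M) :
    GRing.divring_closed S -> (forall u, u \in U -> emb u \in S) ->
    (forall r, r \in rs -> emb r \in S) ->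
  forall u, u \in <<U & rs>>%VS -> emb u \in S.
Proof.
move=> [S1 SB Sdiv]; have S0 : 0%R \in S by rewrite -(subrr 1%R) SB.
have SD x y : x \in S -> y \in S -> (x + y)%R \in S.
  by move=> Sx Sy; rewrite -[y]opprK SB // -[(- y)%R]add0r SB.
have SM x y : x \in S -> y \in S -> (x * y)%R \in S.
  by move=> Sx Sy; rewrite -[y]invrK Sdiv // -[(y^-1)%R]mul1r Sdiv.
have SX x i : x \in S -> (x ^+ i)%R \in S.
  by move=> Sx; elim: i => [|i IHi]; rewrite ?expr0 // exprS SM.
elim: rs U => [|r rs IHrs] U US rsS u; first by rewrite adjoin_nil subfield_closed; apply: US.
rewrite adjoin_cons; apply: (IHrs <<U; r>>%AS) => [v Uv | v rs_v]; last first.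
  by apply: rsS; rewrite inE rs_v orbT.
have /Fadjoin_polyP[P /polyOverP PU ->] := Uv.
rewrite horner_coef rmorph_sum /=; elim/big_ind: _ => // i _.
by rewrite rmorphM rmorphXn SM ?US ?SX ?rsS ?inE ?eqxx.
Qed.

(** * Comparison of F, the character field and the closure *)

Section Main.
Local Open Scope ring_scope.

Variables (gT : finGroupType) (G K : {group gT}) (p n : nat).
Local Notation q := (p ^ n)%N.
Hypotheses (pr_p : prime p) (sKG : K \subset G) (abK : abelian K).
Hypotheses (derG : [~: G, G]%g \subset K) (selfC : 'C_G(K)%g \subset K).
Hypothesis expK : exponent K = q.

Variables (F : fieldType) (L : closedFieldType) (iota : {rmorphism F -> L}).
Hypothesis c0 : [pchar F] =i pred0.

Variables (M : splittingFieldType F) (emb : {rmorphism M -> L}) (z : M).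
Hypotheses (prim_z : q.-primitive_root z) (full_z : <<1; z>>%VS = fullv).
Hypotheses (galM1 : galois 1 {:M}) (emb_alg : forall a : F, emb a%:A = iota a).

Let A := 'Gal({:M} / 1)%G.
Let sg := @gal_mor F M.
Let e := gal_exp q z.
Let D : galois_datum (in_alg M) A sg e q z := gal_datum1 prim_z full_z galM1 c0.
Let cM : [pchar M] =i pred0 := gd_char0 D.
Let cL : [pchar L] =i pred0 := pchar0_rmorph emb cM.
Let primL : q.-primitive_root (emb z).
Proof. by rewrite fmorph_primitive_root. Qed.
Let DL : galois_datum (idfun : {rmorphism L -> L}) (1%G : {group gT})
    (fun _ => idfun : {rmorphism L -> L}) (fun _ => 1%N) q (emb z) := trivial_datum gT cL primL.

Let I := pinertia D sKG abK expK.

(* Its fixed field is F(chi) for every faithful irreducible character chi of G. *)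
Definition frob_image := [set a in A | [exists x in G, powers e K x a]].

Lemma frob_imageP a : reflect (a \in A /\ exists2 x, x \in I & frob A e K x = a) (a \in frob_image).
Proof.
rewrite inE; apply: (iffP andP) => [[Aa /existsP[x /andP[Gx /powersP xa]]] | [Aa [x Ix <-]]].
  split=> //; have [Ix fx] := frob_eq D abK expK Gx Aa xa; by exists x.
have [Gx Ax xP] := frobP Ix.
by split=> //; apply/existsP; exists x; rewrite Gx; apply/powersP.
Qed.

Lemma frob_image_group_set : group_set frob_image.
Proof.
apply/group_setP; split=> [|a b /frob_imageP[Aa [x Ix fx]] /frob_imageP[Ab [y Iy fy]]].
  apply/frob_imageP; split; first exact: group1.
  by have [I1 f1] := frob_K D sKG abK expK (group1 K); exists 1%g.
apply/frob_imageP; split; first exact: groupM.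
have [Ixy fxy] := frob_M D abK expK Ix Iy.
by exists (x * y)%g; rewrite // fxy fx fy.
Qed.
Let B := Group frob_image_group_set.

Let DE : galois_datum (vsval : {rmorphism subvs_of (fixedField B) -> M}) B sg e q z :=
  gal_datum prim_z full_z c0 B.

(** The Galois elements realized by G lie in B by construction, so that enlarging the base field to
    that of B loses nothing of the inertia group. *)
Lemma pinertia_fixed : pinertia_set B e G K = pinertia_set A e G K.
Proof.
apply/setP=> x; rewrite !inE; apply: andb_id2l => Gx.
apply/existsP/existsP=> [[a /andP[/frob_imageP[Aa _] xa]] | [a /andP[Aa xa]]].
  by exists a; rewrite Aa.
exists a; rewrite xa andbT inE Aa; apply/existsP; by exists x; rewrite Gx.
Qed.

Lemma frob_fixed x : x \in I -> frob B e K x = frob A e K x.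
Proof.
move=> Ix; have [Gx Ax xP] := frobP Ix.
have Bx : frob A e K x \in B by apply/frob_imageP; split=> //; exists x.
by have [_ ->] := frob_eq DE abK expK Gx Bx xP.
Qed.

Lemma has_cocycle_fixed lam : has_cocycle DE sKG abK expK lam <-> has_cocycle D sKG abK expK lam.
Proof.
rewrite /has_cocycle /= pinertia_fixed.
split=> -[f [f0 fM f_lam]]; exists f; split=> // x y Ix Iy; rewrite fM //.
  by rewrite frob_fixed.
by rewrite frob_fixed.
Qed.

Lemma frob_onto_fixed a : a \in B ->
  exists2 x, x \in pinertia DE sKG abK expK & frob B e K x = a.
Proof.
case/frob_imageP=> Aa [x Ix fx]; exists x; last by rewrite frob_fixed.
by rewrite /pinertia /= pinertia_fixed.
Qed.

Section OneRepresentation.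

Variables (m : nat) (rho : mx_representation L G m) (lam : gT -> M).
Hypotheses (irr : mx_irreducible rho) (lamP : group_char K lam) (cf : corefree G K lam).
Let lamL := emb \o lam.
Hypothesis nzP : proj (subg_repr (map_repr idfun rho) sKG) lamL != 0.

Let lamLP : group_char K lamL.
Proof.
have [lam1 lamM] := lamP; split=> [|x y Kx Ky]; rewrite /lamL /=; first by rewrite lam1 rmorph1.
by rewrite lamM ?rmorphM.
Qed.

Let cfL : corefree G K lamL.
Proof.
move=> k Kk k1; apply: cf => // x Gx; apply: (fmorph_inj emb).
by rewrite rmorph1 -(k1 x Gx).
Qed.

Let onto1 (a : gT) : a \in 1%G ->
  exists2 x, x \in pinertia DL sKG abK expK & frob 1%G (fun _ : gT => 1%N) K x = a.
Proof.
move/set1gP->; have [I1 f1] := frob_K DL sKG abK expK (group1 K).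
by exists 1%g.
Qed.

(** Over L the inertia group is K, and the character is its own cocycle. *)
Lemma rank_closed : \rank (proj (subg_repr (map_repr idfun rho) sKG) lamL) = 1%N.
Proof.
apply/(rank_proj1 DL (subxx G) abK derG selfC expK lamLP cfL irr nzP).
have IK x : x \in pinertia DL sKG abK expK -> x \in K.
  move=> Ix; rewrite -(frob1 (subxx G) selfC Ix).
  by have /set1gP-> := frob_in Ix.
have [_ lamLM] := lamLP.
exists lamL; split=> // [x /IK Kx | x y /IK Kx /IK Ky]; last by rewrite lamLM.
exact: (group_char_neq0 lamLP).
Qed.

Definition chiM g : M := if g \in K then \sum_(C in rcosets K G) lam (g ^ (repr C)^-1)%g else 0.

Lemma mxtrace_closed g : g \in G -> \tr (rho g) = emb (chiM g).
Proof.
move=> Gg; have := mxtrace_induced (subxx G) derG selfC lamLP cfL irr nzP onto1 Gg.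
rewrite rank_closed mulr1 map_reprE map_mx_id // => ->; rewrite /chiM.
by case: ifP => _; rewrite ?rmorph0 // rmorph_sum.
Qed.

(** The multiplicity of lam in chi. *)
Lemma mean_chiM : #|K|%:R^-1 * \sum_(h in K) lam h^-1%g * chiM h = 1.
Proof.
apply: (fmorph_inj emb); rewrite rmorph1 rmorphM fmorphV rmorph_nat rmorph_sum /=.
have := mxtrace_proj_map idfun sKG rho lamL.
rewrite (mxtrace_proj (subg_repr (map_repr idfun rho) sKG) cL lamLP) rank_closed => tr1.
rewrite -[RHS]/(1%:R : L) tr1; congr (_ * _); apply: eq_bigr => h Kh.
by rewrite rmorphM mxtrace_closed // (subsetP sKG).
Qed.

(** V is irreducible over the fixed field of B and contains lam; the rank s of its lam-eigenspace is
    the multiplicity of rho in V. *)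
Lemma schur_module : exists m' (V : mx_representation (subvs_of (fixedField B)) G m') s,
  [/\ (0 < s <= 2)%N, s = 1%N <-> has_cocycle D sKG abK expK lam
    & forall g, g \in G -> vsval (\tr (V g)) = chiM g * s%:R].
Proof.
have [m' [V [irrV nzV]]] := irreducible_over DE sKG lamP.
exists m', V, (\rank (proj (subg_repr (map_repr vsval V) sKG) lam)); split=> [||g Gg].
- rewrite (rank_proj_gt0 nzV) /=.
  exact: (rank_proj_le2 pr_p DE (subxx G) abK derG selfC expK lamP cf irrV nzV).
- rewrite -has_cocycle_fixed.
  exact: (rank_proj1 DE (subxx G) abK derG selfC expK lamP cf irrV nzV).
have := mxtrace_induced (subxx G) derG selfC lamP cf irrV nzV frob_onto_fixed Gg.
by rewrite map_reprE trace_map_mx.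
Qed.

Lemma chiM_fixed g : g \in G -> chiM g \in fixedField B.
Proof.
move=> Gg; have [m' [V [s [/andP[s_gt0 _] _ trV]]]] := schur_module.
have nzs : s%:R != 0 :> M by rewrite char0_neq0.
by rewrite -[chiM g](mulfK nzs) -trV // rpred_div ?subvsP ?rpred_nat.
Qed.

(** By the Galois correspondence it suffices that any a fixing the values of chi lies in B. Such an
    a maps lam to a constituent of chi, hence to a G-conjugate of lam, and core-freeness yields an
    element of G acting on K as the power e a. *)
Lemma character_field_fixed x : x \in fixedField B -> in_character_field iota rho (emb x).
Proof.
move=> Ex S Sdiv SF Schi; pose rs := [seq chiM g | g <- enum K].
have S1 u : u \in 1%AS -> emb u \in S by move=> /vlineP[k ->]; rewrite emb_alg SF.
have Srs r : r \in rs -> emb r \in S.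
  case/mapP=> g; rewrite mem_enum => Kg ->.
  by rewrite -mxtrace_closed ?Schi ?(subsetP sKG).
apply: (emb_adjoin Sdiv S1 Srs); move: Ex.
have gal_rs : galois <<1 & rs>> {:M}.
  by apply: galoisS galM1; rewrite subv_adjoin_seq subvf.
have /galois_fixedField <- := gal_rs; apply/subvP/fixedFieldS.
apply/subsetP=> a rs_a; have Aa : a \in A.
  by apply: subsetP rs_a; apply: galS; apply: subv_adjoin_seq.
have fix_chi h : h \in K -> sg a (chiM h) = chiM h.
  move=> Kh; apply: (fixed_gal (subvf _) rs_a); apply: seqv_sub_adjoin.
  by apply/mapP; exists h; rewrite ?mem_enum.
pose mu := emb \o (sg a \o lam).
have muP : group_char K mu.
  have [lam1 lamM] := lamP; split=> [|h k Kh Kk]; rewrite /mu /=; first by rewrite lam1 !rmorph1.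
  by rewrite lamM // !rmorphM.
have nzmu : proj (subg_repr (map_repr idfun rho) sKG) mu != 0.
  have tr1 : \tr (proj (subg_repr (map_repr idfun rho) sKG) mu) = 1.
    rewrite mxtrace_proj_map; transitivity (emb (sg a 1)); last by rewrite !rmorph1.
    rewrite -mean_chiM !rmorphM !fmorphV !rmorph_nat !rmorph_sum /=; congr (_ * _).
    apply: eq_bigr => h Kh; rewrite !rmorphM fix_chi // mxtrace_closed // (subsetP sKG) //.
  by apply: contra_eq_neq tr1 => ->; rewrite mxtrace0 eq_sym oner_neq0.
have eigmu := eigen_projr (subg_repr (map_repr idfun rho) sKG) muP.
have [x0 [b [Gx0 _ mu_x0]]] :=
  eigen_constituent DL (subxx G) abK derG expK lamLP cfL irr nzP muP nzmu eigmu.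
apply/frob_imageP; split=> //.
have xP : {in K, forall h, h ^ x0^-1 = h ^+ e a}%g.
  apply: (corefree_power sKG (subxx G) abK derG lamP cf); first by rewrite groupV.
  move=> h Kh; rewrite -(gd_root D Aa) ?(char_root expK lamP) //.
  exact: (fmorph_inj emb (esym (mu_x0 h Kh))).
have [Ix fx] := frob_eq D abK expK (groupVr Gx0) Aa xP.
by exists x0^-1%g.
Qed.

Lemma character_field_sub y : in_character_field iota rho y ->
  exists2 x, x \in fixedField B & y = emb x.
Proof.
(* F(chi) is defined through boolean predicates, hence the classical decision. *)
pose S : {pred L} := fun y =>
  if excluded_middle_informative (exists2 x, x \in fixedField B & y = emb x) then true else false.
have SP t : reflect (exists2 x, x \in fixedField B & t = emb x) (t \in S).
  by rewrite unfold_in /S; case: excluded_middle_informative => [ex | no]; constructor.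
move=> yP; apply/SP; apply: yP => [|a|g Gg].
- split=> [|u v /SP[x Ex ->] /SP[x' Ex' ->]|u v /SP[x Ex ->] /SP[x' Ex' ->]]; apply/SP.
  + by exists 1; rewrite ?rmorph1 // rpred1.
  + by exists (x - x'); rewrite ?rmorphB // rpredB.
  + by exists (x / x'); rewrite ?fmorph_div // rpred_div.
- by apply/SP; exists a%:A; rewrite ?emb_alg // rpredZ ?rpred1.
by apply/SP; exists (chiM g); [apply: chiM_fixed | apply: mxtrace_closed].
Qed.

Lemma multiple_realizable_module m' (V : mx_representation (subvs_of (fixedField B)) G m') s :
  (forall g, g \in G -> vsval (\tr (V g)) = chiM g * s%:R) -> multiple_realizable iota rho s.
Proof.
move=> trV; exists m', (map_repr emb (map_repr vsval V)); split=> [g Gg i i' | g Gg].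
  by rewrite !mxE; apply: character_field_fixed; apply: subvsP.
transitivity (emb (vsval (\tr (V g)))); first by rewrite -2!trace_map_mx.
by rewrite trV // rmorphM rmorph_nat mulr_natr mxtrace_closed.
Qed.

(* A form of rho over F(chi) has a one-dimensional lam-eigenspace after extension to M. *)
Lemma realizable_cocycle : multiple_realizable iota rho 1 -> has_cocycle D sKG abK expK lam.
Proof.
case=> k [theta [Etheta tr_theta]]; rewrite -has_cocycle_fixed.
have ex g i i' : exists y : subvs_of (fixedField B), g \in G -> theta g i i' = emb (vsval y).
  have [Gg | _] := boolP (g \in G); last by exists 0.
  have [x Ex ->] := character_field_sub (Etheta g Gg i i').
  by exists (Subvs Ex).
have ex1 g i : exists f : 'I_k -> subvs_of (fixedField B),
    forall i', g \in G -> theta g i i' = emb (vsval (f i')).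
  by have [f fP] := fin_all_exists (ex g i); exists f.
have ex2 g : exists f : 'I_k -> 'I_k -> subvs_of (fixedField B),
    forall i i', g \in G -> theta g i i' = emb (vsval (f i i')).
  by have [f fP] := fin_all_exists (ex1 g); exists f.
have [f fP] := fin_all_exists ex2.
pose V0 g := \matrix_(i, i') f g i i'.
have V0E g : g \in G -> map_mx emb (map_mx vsval (V0 g)) = theta g.
  by move=> Gg; apply/matrixP=> i i'; rewrite !mxE fP.
have injE : injective (fun X : 'M_k =>
    map_mx emb (map_mx (vsval : subvs_of (fixedField B) -> M) X)).
  by move=> X Y /map_mx_inj/map_mx_inj.
have V0P : mx_repr G V0.
  split=> [|x y Gx Gy]; apply: injE; rewrite /= V0E ?group1 ?groupM //.
    by rewrite repr_mx1 !map_mx1.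
  by rewrite repr_mxM // !map_mxM !V0E.
pose V : mx_representation (subvs_of (fixedField B)) G k := MxRepresentation V0P.
apply: (line_cocycle DE (subxx G) abK derG expK (rH := V) lamP).
apply: (natr_inj D); rewrite -(mxtrace_proj (subg_repr (map_repr vsval V) sKG) cM lamP).
rewrite mxtrace_proj_map -[RHS]mean_chiM; congr (_ * _); apply: eq_bigr => h Kh.
have Gh := subsetP sKG h Kh; congr (_ * _); apply: (fmorph_inj emb).
rewrite -mxtrace_closed // -[RHS]mulr1n -tr_theta // -V0E //.
by rewrite !trace_map_mx.
Qed.

Lemma schur_index_cocycle :
  is_schur_index iota rho
    (if excluded_middle_informative (has_cocycle D sKG abK expK lam) then 1 else 2)%N.
Proof.
have [m' [V [s [/andP[s_gt0 s_le2] s1 trV]]]] := schur_module.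
have real_s := multiple_realizable_module trV.
case: excluded_middle_informative => [co | no_co].
  by rewrite (s1.2 co) in real_s; split=> // m1 m1_gt0.
have Ds : s = 2%N by case: (s) s_gt0 s_le2 s1 => [|[|[|]]] // _ _ [/(_ erefl)].
split=> // [|m1 m1_gt0 real_m1]; first by rewrite -Ds.
rewrite ltn_neqAle m1_gt0 andbT; apply/eqP=> D1; apply: no_co.
by apply: realizable_cocycle; rewrite D1.
Qed.

End OneRepresentation.

Lemma schur_index_faithful m (rho : mx_representation L G m) : faithful_irr rho ->
  exists lam, [/\ group_char K lam, corefree G K lam
    & is_schur_index iota rho
        (if excluded_middle_informative (has_cocycle D sKG abK expK lam) then 1 else 2)%N].
Proof.
case=> irr ff.
have [lamL [lamLP cfL nzP]] :=
  corefree_constituent DL sKG (subxx G) abK derG expK irr (faithful_core ff).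
(* The values of lamL are q-th roots of unity, hence come from M. *)
have ex h : exists y : M, h \in K -> lamL h = emb y.
  have [Kh | _] := boolP (h \in K); last by exists 0.
  have [i ->] := prim_rootP primL (char_root expK lamLP Kh).
  by exists (z ^+ i); rewrite rmorphXn.
have [lam lamE] := fin_all_exists ex.
have lamP : group_char K lam.
  have [lam1 lamM] := lamLP; split=> [|h k Kh Kk]; apply: (fmorph_inj emb).
    by rewrite -lamE ?group1 // lam1 rmorph1.
  by rewrite rmorphM -!lamE ?groupM // lamM.
have cf : corefree G K lam.
  move=> k Kk k1; apply: cfL => // x Gx.
  by rewrite lamE ?k1 ?rmorph1 // (memKJ sKG (subxx G) derG).
exists lam; split=> //; apply: schur_index_cocycle => //.
by rewrite (@eq_proj _ _ _ _ _ (emb \o lam) lamL) // => h Kh; rewrite lamE.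
Qed.

Lemma degree_faithful m (theta : mx_representation F G m) : faithful_irr theta ->
  exists lam, [/\ group_char K lam, corefree G K lam
    & m = (#|G : I| * \dim {:M} *
           (if excluded_middle_informative (has_cocycle D sKG abK expK lam) then 1 else 2))%N].
Proof.
case=> irr ff; have [lam [lamP cf nzP]] :=
  corefree_constituent D sKG (subxx G) abK derG expK irr (faithful_core ff).
exists lam; split=> //.
have le2 := rank_proj_le2 pr_p D (subxx G) abK derG selfC expK lamP cf irr nzP.
have rk1 := rank_proj1 D (subxx G) abK derG selfC expK lamP cf irr nzP.
have gt0 := rank_proj_gt0 nzP.
rewrite [LHS](degree_proj D (subxx G) abK derG expK lamP cf irr nzP) (card_gal galM1).
congr (_ * _)%N; case: excluded_middle_informative => [co | no_co]; first exact/rk1.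
by apply/eqP; rewrite eqn_leq le2 ltn_neqAle gt0 andbT; apply/eqP => /esym/rk1.
Qed.

Let nKG : G \subset 'N(K)%g.
Proof. by rewrite -commg_subr (subset_trans _ derG) // commgSS. Qed.

(** * Irreducible representations of K with core-free kernel *)

Section CorefreeModule.

Variables (d : nat) (eta : mx_representation F K d) (lam : gT -> M).
Hypotheses (irr : mx_irreducible eta) (lamP : group_char K lam) (cf : corefree G K lam).
Let j : {rmorphism F -> M} := in_alg M.
Let etaM := map_repr j eta.
Hypothesis nzP : proj (subg_repr etaM (subxx K)) lam != 0.

Lemma pinertia_self : pinertia D (subxx K) abK expK = K.
Proof. by apply/val_inj/eqP; rewrite eqEsubset pinertia_sub sub_pinertia. Qed.

(** The structure results with H = K: the inertia group is K, lam is its own cocycle, and each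
    Galois conjugate of lam occurs once. *)
Lemma degree_corefree : d = \dim {:M}.
Proof.
rewrite [LHS](degree_proj D sKG abK derG expK lamP cf irr nzP) pinertia_self indexgg mul1n.
rewrite (card_gal galM1) (_ : \rank _ = 1%N) ?muln1 //.
apply/(rank_proj1 D sKG abK derG selfC expK lamP cf irr nzP).
have [_ lamM] := lamP; rewrite /has_cocycle pinertia_self.
exists lam; split=> // [x Kx | x y Kx Ky]; first exact: (group_char_neq0 lamP).
by have [_ ->] := frob_K D (subxx K) abK expK Ky; rewrite (gd1 D) lamM.
Qed.

(** A column eigenvector u of eta and a row eigenvector w of its conjugate for the same lam give an
    intertwiner u w over M. A trace makes it rational and nonzero, and irreducibility makes it
    invertible. *)
Lemma conj_corefree g (nKg : g \in 'N(K)%g) : g \in I -> mx_rsim (conj_repr eta nKg) eta.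
Proof.
move=> Ig; have Ig' := groupVr Ig; have [Gg' Aa gP] := frobP Ig'.
set a := frob A e K g^-1%g in Aa gP.
have [v nzv eigv] := proj_row D lamP nzP.
pose w := map_mx (sg a^-1%g) v.
have wP h : h \in K -> w *m etaM (h ^ g^-1)%g = lam h *: w.
  move=> Kh; have Kh' : (h ^ g^-1)%g \in K by rewrite memJ_norm // groupV.
  rewrite -(map_rM D eta _ (groupVr Aa)) -map_mxM; have /= -> := eigv _ Kh'.
  rewrite map_mxZ; congr (_ *: _); rewrite gP // (group_charX _ lamP) //.
  by rewrite -(gd_root D Aa) ?(char_root expK lamP) // (gdVK D).
have [i nzi] : exists i, col i (proj (subg_repr etaM (subxx K)) lam) != 0.
  apply/existsP; apply: contraR nzP => /existsPn P0.
  apply/eqP/matrixP=> s t; have /negPn/eqP/colP/(_ s) := P0 t.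
  by rewrite !mxE.
set u := col i _ in nzi.
have uP h : h \in K -> etaM h *m u = lam h *: u.
  move=> Kh; have /= e1 := eigen_projl (subg_repr etaM (subxx K)) lamP Kh.
  by rewrite /u !colE mulmxA e1 -scalemxAl.
pose X := u *m w.
have nzX : X != 0.
  have /rV0Pn[t nzt] : w != 0 by rewrite map_mx_eq0.
  have /cV0Pn[s nzs] := nzi.
  apply/eqP=> /matrixP/(_ s t)/eqP; rewrite !mxE big_ord1 mulf_eq0.
  by rewrite (negPf nzs) (negPf nzt).
have [X0 [k [nzX0 DX0]]] := gd_trace D nzX.
have homX h : h \in K -> eta h *m X0 = X0 *m eta (h ^ g^-1)%g.
  move=> Kh; apply/(map_mx_inj (f := j)); rewrite !map_mxM DX0.
  rewrite mulmx_sumr mulmx_suml; apply: eq_bigr => b Ab.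
  rewrite -scalemxAr -scalemxAl; congr (_ *: _).
  have Kh' : (h ^ g^-1)%g \in K by rewrite memJ_norm // groupV.
  rewrite -[map_mx j (eta h)](map_rM D eta h Ab) -[map_mx j (eta _)](map_rM D eta _ Ab).
  by rewrite -!map_mxM /X mulmxA uP // -(mulmxA u w) wP // -scalemxAl -scalemxAr.
apply: mx_rsim_sym; exists X0 => //.
  rewrite -kermx_eq0; apply: contraNT nzX0 => nzker.
  have [_ /(_ (kermx X0)) irr0] := (mx_irrP _).1 irr.
  have kermod : mxmodule eta (kermx X0).
    apply/mxmoduleP=> h Kh; apply/sub_kermxP.
    by rewrite -mulmxA homX // mulmxA mulmx_ker mul0mx.
  have := irr0 kermod nzker; rewrite -sub1mx => /sub_kermxP.
  by rewrite mul1mx => ->.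
Qed.

(** A lam-eigenvector of eta has character mu in the conjugate representation, so the isomorphism
    makes mu a constituent of eta, hence a Galois conjugate of lam. *)
Lemma pinertia_conj g (nKg : g \in 'N(K)%g) : g \in G -> mx_rsim (conj_repr eta nKg) eta -> g \in I.
Proof.
move=> Gg [X eq_d freeX homX]; have [v nzv eigv] := proj_row D lamP nzP.
pose mu h := lam (h ^ g^-1)%g.
have KJ h : h \in K -> (h ^ g^-1)%g \in K by move=> Kh; rewrite memJ_norm // groupV.
have muP : group_char K mu.
  have [lam1 lamM] := lamP; split=> [|x y Kx Ky]; rewrite /mu; first by rewrite conj1g.
  by rewrite conjMg lamM ?KJ.
pose w := v *m map_mx j X.
have nzw : w != 0.
  have freeM : row_free (map_mx j X) by rewrite /row_free mxrank_map.
  by rewrite -mxrank_eq0 mxrankMfree // mxrank_eq0.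
have eigw : eigen (subg_repr etaM (subxx K)) mu w.
  move=> h Kh; rewrite /w -mulmxA /= map_reprE -map_mxM -homX //= map_mxM mulmxA.
  by have /= -> := eigv _ (KJ h Kh); rewrite -scalemxAl.
have [x [a [Kx Aa mu_xa]]] :=
  eigen_constituent D sKG abK derG expK lamP cf irr nzP muP nzw eigw.
have gP : {in K, forall h, h ^ g^-1 = h ^+ e a}%g.
  apply: (corefree_power sKG (subxx G) abK derG lamP cf); first by rewrite groupV.
  move=> h Kh; rewrite -/(mu h) mu_xa // /conj_char -(gd_root D Aa) ?(char_root expK lamP) //.
  congr (sg a (lam _)); apply/conjg_fixP/commgP/(centsP abK) => //; exact: groupVr.
have [Ig _] := frob_eq D abK expK (groupVr Gg) Aa gP.
by rewrite -groupV.
Qed.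

End CorefreeModule.

Lemma corefree_module d (eta : mx_representation F K d) : corefree_irr G eta ->
  d = \dim {:M} /\ is_inertia G eta I.
Proof.
case=> irr cfr; have [lam [lamP cf nzP]] :=
  corefree_constituent D (subxx K) sKG abK derG expK irr (core_free_core cfr).
split; first exact: degree_corefree irr lamP cf nzP.
move=> g; split=> [Ig | [Gg [nKg sim]]]; last first.
  exact: (pinertia_conj irr lamP cf nzP Gg sim).
have [Gg _ _] := frobP Ig; split=> //.
by exists (subsetP nKG g Gg); exact: (conj_corefree irr lamP nzP (subsetP nKG g Gg) Ig).
Qed.

Lemma corefree_module_exists m (theta : mx_representation F G m) : faithful_irr theta ->
  exists d (eta : mx_representation F K d), corefree_irr G eta.
Proof.
case=> irr ff; have [lam [lamP cf nzP]] :=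
  corefree_constituent D sKG (subxx G) abK derG expK irr (faithful_core ff).
have [d [eta [irr_eta nz_eta]]] := irreducible_over D (subxx K) lamP.
exists d, eta; split=> //; apply/eqP/trivgP/subsetP=> k Nk; apply/set1gP.
have [v nzv eigv] := proj_row D lamP nz_eta.
have sNK : gcore (rker eta) G \subset K by rewrite (subset_trans (gcore_sub _ _)) ?rstab_sub.
have nN := gcore_norm (rker eta) G.
apply: (cf k) => [|x Gx]; first exact: (subsetP sNK).
have Nkx : (k ^ x)%g \in gcore (rker eta) G by rewrite memJ_norm // (subsetP nN).
have /rkerP[Kkx etakx] := subsetP (gcore_sub _ _) _ Nkx.
have /= := eigv _ Kkx; rewrite map_reprE etakx map_mx1 mulmx1 => e1.
have /eqP : (lam (k ^ x)%g - 1) *: v = 0 by rewrite scalerBl scale1r -e1 subrr.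
by rewrite scaler_eq0 (negPf nzv) orbF subr_eq0 => /eqP.
Qed.

End Main.

Section SelfCentralizing.

Variables (gT : finGroupType) (G K : {group gT}).
Hypothesis maxK : pp_max_abelian_normal G K.

Lemma max_abelian_normal_sub : K \subset G /\ abelian K.
Proof. by have [/maxgroupP[/andP[/normal_sub]]] := maxK. Qed.

Lemma commg_sub_max : [~: G, G] \subset K.
Proof. by have [_ _] := maxK. Qed.

(** Adjoining to K an element of its centralizer keeps it abelian, and normal because it contains
    G'. *)
Lemma max_abelian_normal_cent : 'C_G(K) \subset K.
Proof.
have [sKG abK] := max_abelian_normal_sub.
apply/subsetP=> g /setIP[Gg Cg]; have [/maxgroupP[_ maxP] _ _] := maxK.
have sKE : K \subset K <*> <[g]> by apply: joing_subl.
have sEG : K <*> <[g]> \subset G by rewrite join_subG sKG cycle_subG.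
have <- : (K <*> <[g]>)%G = K :> {set gT}.
  apply: maxP (sKE); apply/andP; split; last first.
    by rewrite abelianY abK cycle_abelian /= cycle_subG.
  rewrite /normal sEG -commg_subr.
  exact: subset_trans (commgS G sEG) (subset_trans commg_sub_max sKE).
by rewrite (subsetP (joing_subr _ _)) ?cycle_id.
Qed.

Lemma exponent_prime_power : exists p n : nat, prime p /\ exponent K = (p ^ n)%N.
Proof.
have [_ [p [k [pr_p oK]]] _] := maxK; exists p.
have /(dvdn_pfactor _ _ pr_p)[n _ ->] : exponent K %| (p ^ k)%N.
  by rewrite -oK exponent_dvdn.
by exists n.
Qed.

End SelfCentralizing.

Local Open Scope ring_scope.

Theorem theorem1p0p1 (gT : finGroupType) (G : {group gT})
    (F : fieldType) (Fbar : closedFieldType) (iota : {rmorphism F -> Fbar})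
    (char0 : [pchar F] =i pred0)
    (algFbar : is_algebraic_closure iota)
    (metaG : is_metabelian G)
    (exK : exists K : {group gT}, pp_max_abelian_normal G K) :
  [/\ (* (1) *)
      (forall (n n' : nat) (rho : mx_representation Fbar G n)
          (rho' : mx_representation Fbar G n'),
        faithful_irr rho -> faithful_irr rho' -> ~ mx_rsim rho rho' ->
        exists m : nat, is_schur_index iota rho m /\ is_schur_index iota rho' m),
      (* (2) *)
      (forall (m m' : nat) (theta : mx_representation F G m)
          (theta' : mx_representation F G m'),
        faithful_irr theta -> faithful_irr theta' -> m = m'),
      (* (3) *)
      (forall (n : nat) (rho : mx_representation Fbar G n),
        faithful_irr rho -> is_schur_index iota rho 1 \/ is_schur_index iota rho 2)
    & (* (4) *)
      (forall (K : {group gT}) (p n : nat),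
        pp_max_abelian_normal G K -> prime p -> exponent K = (p ^ n)%N ->
        exists (d : nat) (I : {group gT}),
          [/\ (forall q : {poly F}, irreducible_poly q ->
                 q %| cyclotomic_over F (p ^ n) -> (size q).-1 = d),
              (forall (e : nat) (eta : mx_representation F K e),
                 corefree_irr G eta -> e = d /\ is_inertia G eta I),
              ((exists (m : nat) (theta : mx_representation F G m),
                  faithful_irr theta) ->
               exists (e : nat) (eta : mx_representation F K e),
                 corefree_irr G eta)
            & (forall (m : nat) (theta : mx_representation F G m),
                 faithful_irr theta ->
                 m = (#|G : I| * d)%N \/ m = (2 * (#|G : I| * d))%N)])].
Proof.
(* Any single K0 serves for (1) to (3); (4) is proved for each K with its own cyclotomic field. *)
have [K0 maxK0] := exK; have [p0 [n0 [pr_p0 expK0]]] := exponent_prime_power maxK0.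
have [sK0G abK0] := max_abelian_normal_sub maxK0.
have derG0 := commg_sub_max maxK0; have selfC0 := max_abelian_normal_cent maxK0.
have q0_gt0 : (0 < p0 ^ n0)%N by rewrite expn_gt0 prime_gt0.
have [M0 [emb0 [z0 [prim0 full0 gal0 alg0 _]]]] := cyclotomic_extension iota q0_gt0 char0.
pose D0 := gal_datum1 prim0 full0 gal0 char0.
have schur0 := schur_index_faithful pr_p0 sK0G abK0 derG0 selfC0 expK0
  char0 prim0 full0 gal0 alg0.
have degree0 := degree_faithful pr_p0 sK0G abK0 derG0 selfC0 expK0 char0 prim0 full0 gal0.
have transfer lam lam' : group_char K0 lam -> corefree G K0 lam ->
    group_char K0 lam' -> corefree G K0 lam' ->
    (if excluded_middle_informative (has_cocycle D0 sK0G abK0 expK0 lam) then 1 else 2)%N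
    = (if excluded_middle_informative (has_cocycle D0 sK0G abK0 expK0 lam') then 1 else 2)%N.
  move=> lamP cf lamP' cf'.
  have tr mu mu' := @cocycle_transfer _ _ _ _ _ _ _ _ _ _ pr_p0 D0 _ _ _ _ sK0G
    (subxx G) abK0 derG0 selfC0 expK0 mu mu'.
  case: excluded_middle_informative => c; case: excluded_middle_informative => // c'.
    by case: c'; apply: tr c.
  by case: c; apply: tr c'.
split.
- move=> n n' rho rho' /schur0[lam [lamP cf S]] /schur0[lam' [lamP' cf' S']] _.
  by eexists; split; [exact: S | rewrite (transfer _ _ lamP cf lamP' cf')].
- move=> m m' theta theta' /degree0[lam [lamP cf ->]] /degree0[lam' [lamP' cf' ->]].
  by rewrite (transfer _ _ lamP cf lamP' cf').
- move=> n rho /schur0[lam [_ _]].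
  by case: excluded_middle_informative => ? S; [left | right].
move=> K p n maxK pr_p expK; have [sKG abK] := max_abelian_normal_sub maxK.
have derG := commg_sub_max maxK; have selfC := max_abelian_normal_cent maxK.
have q_gt0 : (0 < p ^ n)%N by rewrite expn_gt0 prime_gt0.
have [M [emb [z [prim full gal alg deg]]]] := cyclotomic_extension iota q_gt0 char0.
pose D := gal_datum1 prim full gal char0.
exists (\dim {:M}), (pinertia D sKG abK expK); split.
- exact: deg.
- exact: (corefree_module sKG abK derG selfC expK char0 prim full gal).
- move=> [m [theta ff]].
  exact: (corefree_module_exists sKG abK derG expK char0 prim full gal ff).
move=> m theta ff; have [lam [_ _ ->]] := degree_faithful pr_p sKG abK derG selfC expK
  char0 prim full gal ff.
by case: excluded_middle_informative => ?; [left; rewrite muln1 | right; rewrite mulnC].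
Qed.
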